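(* Let $n\ge 1$, let $D=\{z\in\mathbb{C}^n:|z|<1\}$, and let $\mathcal{F}$ be a family of holomorphic functions $f:D\to\mathbb{C}$. If $\mathcal{F}$ is not normal on $D$, then for every real $\alpha$ with $0\le\alpha<1$ there exist a real number $r$ with $0<r<1$, a sequence $\{z_j\}\subseteq D$ with $|z_j|<r$ for all $j$, a sequence $\{f_j\}\subseteq\mathcal{F}$, and a sequence $\{\rho_j\}\subset(0,1]$ with $\rho_j\to 0$, such that the sequence $$g_j(\zeta)=\frac{f_j(z_j+\rho_j\zeta)}{\rho_j^{\alpha}}$$ converges locally uniformly in $\mathbb{C}^n$ to a nonconstant entire function $g$ on $\mathbb{C}^n$.
   Context: $|\cdot|$ is the Euclidean norm on $\mathbb{C}^n$. A family $\mathcal{F}$ of holomorphic functions $f:D\to\mathbb{C}$ on a domain $D\subseteq\mathbb{C}^n$ is normal on $D$ if every sequence in $\mathcal{F}$ contains a subsequence that converges locally uniformly on $D$ to a limit function which is either holomorphic on $D$ or identically equal to $\infty$. An entire function on $\mathbb{C}^n$ is a holomorphic function $\mathbb{C}^n\to\mathbb{C}$. The function $g_j$ is defined on $\{\zeta\in\mathbb{C}^n: z_j+\rho_j\zeta\in D\}$; locally uniform convergence in $\mathbb{C}^n$ means that for every compact $K\subset\mathbb{C}^n$, $g_j$ is defined on $K$ for all sufficiently large $j$ and converges uniformly to $g$ on $K$. *)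

(* Defs.v *)
From HB Require Import structures.
From mathcomp Require Import all_boot all_order all_algebra.
From mathcomp Require Import complex.
From mathcomp Require Import all_classical all_reals all_analysis.

Set Implicit Arguments.
Unset Strict Implicit.
Unset Printing Implicit Defensive.

Import Order.TTheory GRing.Theory Num.Theory numFieldNormedType.Exports.
Import ComplexField.Normc.

Local Open Scope classical_set_scope.
Local Open Scope ring_scope.

(* [complex R] itself carries no topology: the topological and normed
   structures are found through the coercion from [numFieldType]. *)
Definition Cplx (R : realType) : numFieldType := R[i].

Definition ofR (R : realType) (x : R) : Cplx R := (x%:C)%C.

(* A function on a subset of C^n is represented by a total function whose
   values outside of that subset are irrelevant. *)

Section Definitions.
Context {R : realType} {n : nat}.
Local Notation C := (Cplx R).
Local Notation Cn := 'rV[C]_n.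

(* The library norm on ['rV[C]_n] is the sup norm; it defines the same
   topology as [enorm]. *)
Definition enorm (z : Cn) : R := Num.sqrt (\sum_(i < n) normc (z ord0 i) ^+ 2).

Definition unit_ball : set Cn := [set z | enorm z < 1].

(* [differentiable] is over the base field of [Cn], that is, C-linear. *)
Definition holomorphic_on (U : set Cn) (f : Cn -> C) : Prop :=
  forall z, U z -> differentiable f z.

(* Locally uniform convergence on [U] to [g] of functions [f_ j], the j-th of
   which is only meaningful on [dom j]. *)
Definition cvg_loc_unif (U : set Cn) (dom : nat -> set Cn)
    (f_ : nat -> Cn -> C) (g : Cn -> C) : Prop :=
  forall K : set Cn, compact K -> K `<=` U ->
    (\forall j \near \oo, K `<=` dom j) /\ {uniform K, f_ @ \oo --> g}.

Definition cvg_loc_unif_infty (U : set Cn) (f_ : nat -> Cn -> C) : Prop :=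
  forall K : set Cn, compact K -> K `<=` U ->
    forall M : R, \forall j \near \oo, forall z, K z -> M < normc (f_ j z).

Definition normal_on (U : set Cn) (F : set (Cn -> C)) : Prop :=
  forall f_ : nat -> Cn -> C, (forall j, F (f_ j)) ->
    exists phi : nat -> nat, increasing_seq phi /\
      ((exists g, holomorphic_on U g /\
          cvg_loc_unif U (fun=> U) (fun j => f_ (phi j)) g) \/
       cvg_loc_unif_infty U (fun j => f_ (phi j))).

Definition entire (g : Cn -> C) : Prop := holomorphic_on setT g.

Definition nonconstant (g : Cn -> C) : Prop :=
  ~ exists c : C, forall z, g z = c.

End Definitions.

Arguments unit_ball : clear implicits.

(* Main.v *)
Require Import Defs.
From HB Require Import structures.
From mathcomp Require Import all_boot all_order all_algebra.
From mathcomp Require Import complex ring lra.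
From mathcomp Require Import all_classical all_reals all_analysis.
Import Order.TTheory GRing.Theory Num.Theory numFieldNormedType.Exports.
Import ComplexField.Normc.
Local Open Scope classical_set_scope.
Local Open Scope ring_scope.

Set Implicit Arguments.
Unset Strict Implicit.
Unset Printing Implicit Defensive.

(* Pang's version of Zalcman's argument.  If the spherical derivatives
   |f'| / (1 + |f|^2) of the members of F were bounded on each smaller ball, F
   would be normal by Marty's criterion.  Otherwise consider, for a member f with
   a large spherical derivative, the pairs (z, rho) at which the rescaled
   function f(z + rho zeta) / rho^alpha has spherical derivative at least 1 at
   the origin, and among them one that nearly minimizes rho / (q - |z|^2), where
   q = r^2.  This ratio has a positive infimum because alpha < 1, it tends to 0
   along the sequence, and near-minimality bounds the spherical derivative of the
   rescaled functions by an absolute constant on larger and larger balls.  Marty's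
   criterion then gives a convergent subsequence; the limit is neither constant
   nor infinity, as the spherical derivative at the origin stays at least 1.

   Complex differentiability at every point is all that is assumed, so the
   one-variable theory starts from Goursat's theorem on rectangles; several
   variables are reduced to one by restriction to complex lines.  Limits are taken
   along an ultrafilter on the integers, and a subsequence is extracted only at
   the very end. *)

(** The choice of [(z, rho)] tolerates a factor 2 because continuity of the derivative is never
    established, so the infimum need not be known to be attained. That it is positive only takes a
    bound for the derivatives on smaller balls, which follows from Cauchy's estimate and
    compactness.

    Along an ultrafilter a pointwise bounded sequence converges at all points at once, and a
    sequence of numbers is either bounded or tends to infinity. Marty's criterion therefore needs no
    diagonal argument over a dense set; the real obstacle is that points of the two kinds must not
    coexist. Hurwitz's theorem, applied to reciprocals on complex lines, makes the infinite points
    an open set, the chordal estimate does so for the finite ones, and segments are connected.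

    The number 2 pi i is never computed: it is enough that the integral of [1 / z] around a square
    does not depend on its size and has modulus at least 4. Cauchy's estimate then holds with a
    crude constant 48, and the thresholds 96 are twice that. *)

Section RealNorm.
Context {R : realType}.
Local Notation C := (Cplx R).

(* The norm of a complex normed module takes its values in [C]; [rnorm] is the
   same norm with values in [R]. *)
Definition rnorm (V : normedModType C) (v : V) : R := complex.Re `|v|.

Lemma ofRE (x : R) : ofR x = (x%:C)%C. Proof. by []. Qed.

Lemma ofR_rnorm (V : normedModType C) (v : V) : ofR (rnorm v) = `|v|.
Proof. exact/RRe_real/normr_real. Qed.

Lemma absCE (z : C) : `|z| = ofR (normc z). Proof. by []. Qed.

Lemma rnormE (z : C) : rnorm z = normc z. Proof. by []. Qed.

Lemma ofR_le (x y : R) : (ofR x <= ofR y) = (x <= y). Proof. exact: lecR. Qed.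
Lemma ofR_lt (x y : R) : (ofR x < ofR y) = (x < y). Proof. exact: ltcR. Qed.

Lemma ofRD (x y : R) : ofR (x + y) = ofR x + ofR y.
Proof. exact: (rmorphD (real_complex R)). Qed.
Lemma ofRM (x y : R) : ofR (x * y) = ofR x * ofR y.
Proof. exact: (rmorphM (real_complex R)). Qed.
Lemma ofRN (x : R) : ofR (- x) = - ofR x.
Proof. exact: (rmorphN (real_complex R)). Qed.
Lemma ofRV (x : R) : ofR x^-1 = (ofR x)^-1.
Proof. exact: (fmorphV (real_complex R)). Qed.
Lemma ofR0 : ofR 0 = 0 :> C. Proof. by []. Qed.
Lemma ofR1 : ofR 1 = 1 :> C. Proof. by []. Qed.
Lemma ofR_eq0 (x : R) : (ofR x == 0) = (x == 0).
Proof. by rewrite -(inj_eq (@complexI R)). Qed.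

Lemma ofR_gt0P (e : C) : 0 < e -> exists2 d : R, 0 < d & e = ofR d.
Proof.
case: e => a b; rewrite ltcE /= => /andP[/eqP -> a0].
by exists a.
Qed.

Section Norm.
Context (V : normedModType C).
Implicit Types v w : V.

Lemma rnorm_ge0 v : 0 <= rnorm v.
Proof. by rewrite -ofR_le ofR_rnorm normr_ge0. Qed.

Lemma rnorm0 : rnorm (0 : V) = 0.
Proof. by rewrite /rnorm normr0. Qed.

Lemma rnorm_eq0 v : (rnorm v == 0) = (v == 0).
Proof. by rewrite -ofR_eq0 ofR_rnorm normr_eq0. Qed.

Lemma rnormD v w : rnorm (v + w) <= rnorm v + rnorm w.
Proof. by rewrite -ofR_le ofRD !ofR_rnorm ler_normD. Qed.

Lemma rnormN v : rnorm (- v) = rnorm v.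
Proof. by rewrite /rnorm normrN. Qed.

Lemma rnormB v w : rnorm (v - w) <= rnorm v + rnorm w.
Proof. by rewrite -[rnorm w]rnormN rnormD. Qed.

Lemma rdistC v w : rnorm (v - w) = rnorm (w - v).
Proof. by rewrite /rnorm distrC. Qed.

Lemma rnormZ (a : C) v : rnorm (a *: v) = normc a * rnorm v.
Proof. by apply: (@complexI R); rewrite -!ofRE ofRM !ofR_rnorm normrZ. Qed.

Lemma rnorm_ball v w (e : R) : ball v (ofR e) w = (rnorm (v - w) < e) :> Prop.
Proof. by rewrite -ball_normE /= -ofR_rnorm ofR_lt. Qed.

Lemma rnorm_nbhsP v (A : set V) :
  nbhs v A <-> exists2 e : R, 0 < e & forall w, rnorm (w - v) < e -> A w.
Proof.
split=> [/nbhs_ballP[_ /= /ofR_gt0P[e e0 ->]] H | [e e0 H]].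
  by exists e => // w wv; apply: H; rewrite rnorm_ball rdistC.
apply/nbhs_ballP; exists (ofR e) => /=; first by rewrite -ofR0 ofR_lt.
by move=> w; rewrite rnorm_ball rdistC => /H.
Qed.

End Norm.

Implicit Types z w : C.

Lemma normc_ge0 z : 0 <= normc z. Proof. exact: (@rnorm_ge0 C). Qed.
Lemma normcD z w : normc (z + w) <= normc z + normc w.
Proof. exact: (@rnormD C). Qed.
Lemma normc_oppr z : normc (- z) = normc z. Proof. exact: (@rnormN C). Qed.
Lemma normcB z w : normc (z - w) <= normc z + normc w.
Proof. exact: (@rnormB C). Qed.
Lemma normc_distC z w : normc (z - w) = normc (w - z).
Proof. exact: (@rdistC C). Qed.
Lemma normc_eq0 z : (normc z == 0) = (z == 0). Proof. exact: (@rnorm_eq0 C). Qed.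
Lemma normc_gt0 z : (0 < normc z) = (z != 0).
Proof. by rewrite lt_neqAle normc_ge0 andbT eq_sym normc_eq0. Qed.
Lemma normcX z n : normc (z ^+ n) = normc z ^+ n.
Proof. by elim: n => [|n IH]; rewrite ?expr0 ?normc1// !exprS normcM IH. Qed.
Lemma normc_ofR (x : R) : normc (ofR x) = `|x|.
Proof. by rewrite /= expr0n /= addr0 sqrtr_sqr. Qed.

Lemma Re_le_normc z : `|complex.Re z| <= normc z.
Proof.
by case: z => a b /=; rewrite -sqrtr_sqr ler_wsqrtr // lerDl sqr_ge0.
Qed.
Lemma Im_le_normc z : `|complex.Im z| <= normc z.
Proof.
by case: z => a b /=; rewrite -sqrtr_sqr ler_wsqrtr // lerDr sqr_ge0.
Qed.

Lemma normc_le_ReIm z : normc z <= `|complex.Re z| + `|complex.Im z|.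
Proof.
case: z => a b /=; rewrite -(@ler_pXn2r _ 2) ?nnegrE ?sqrtr_ge0 ?addr_ge0 //.
rewrite sqr_sqrtr ?addr_ge0 ?sqr_ge0// sqrrD !real_normK ?num_real//.
by rewrite -addrA lerD2l lerDr mulrn_wge0// mulr_ge0.
Qed.

Lemma cReD z w : complex.Re (z + w) = complex.Re z + complex.Re w.
Proof. by case: z; case: w. Qed.
Lemma cImD z w : complex.Im (z + w) = complex.Im z + complex.Im w.
Proof. by case: z; case: w. Qed.
Lemma cReB z w : complex.Re (z - w) = complex.Re z - complex.Re w.
Proof. by case: z; case: w. Qed.
Lemma cImB z w : complex.Im (z - w) = complex.Im z - complex.Im w.
Proof. by case: z; case: w. Qed.
Lemma cReM z w : complex.Re (z * w) =
  complex.Re z * complex.Re w - complex.Im z * complex.Im w.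
Proof. by case: z; case: w. Qed.
Lemma cImM z w : complex.Im (z * w) =
  complex.Re z * complex.Im w + complex.Im z * complex.Re w.
Proof. by case: z; case: w. Qed.
Lemma normc_sqr z : normc z ^+ 2 = complex.Re z ^+ 2 + complex.Im z ^+ 2.
Proof. by case: z => a b /=; rewrite sqr_sqrtr// addr_ge0 ?sqr_ge0. Qed.
Lemma ReImP z w : complex.Re z = complex.Re w -> complex.Im z = complex.Im w ->
  z = w.
Proof. by case: z; case: w => a b c d /= -> ->. Qed.

(** * Differentials as epsilon-delta approximations *)

Lemma differentiable_approx (V : normedModType C) (f : V -> C) (x : V) :
  differentiable f x -> forall e : R, 0 < e ->
  exists2 d : R, 0 < d & forall h, rnorm h < d ->
    normc (f (x + h) - f x - 'd f x h) <= e * rnorm h.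
Proof.
move=> df e e0.
have /eqaddoP /(_ (ofR e)) := diff_locally df.
rewrite -ofR0 ofR_lt => /(_ e0) /rnorm_nbhsP[d d0 H].
exists d => // h hd; have := H h; rewrite subr0 => /(_ hd).
rewrite -[`|id h|]ofR_rnorm -ofRM absCE ofR_le /=.
by rewrite !fctE /= [h + x]addrC opprD addrA.
Qed.

(** The bound by [k] makes [L] continuous, as a differential must be. The lemma serves a limit of
    differentials, which arises as a bare function whose linearity and bound are proved
    separately. *)
Lemma approx_differentiable (V : normedModType C) (f : V -> C) (x : V)
    (L : V -> C) (k : R) :
  linear L -> (forall v, normc (L v) <= k * rnorm v) ->
  (forall e : R, 0 < e -> exists2 d : R, 0 < d & forall h, rnorm h < d ->
    normc (f (x + h) - f x - L h) <= e * rnorm h) ->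
  differentiable f x.
Proof.
move=> Ll Lk fL.
pose LL := GRing.isLinear.Build C V C *:%R L Ll.
pose L' : {linear V -> C} := HB.pack L LL.
have Lc : continuous L'.
  apply: bounded_linear_continuous; apply/linear_boundedP.
  exists (ofR k); split=> [|r kr v]; first by apply/complex_realP; exists k.
  rewrite (@le_trans _ _ (ofR k * `|v|)) ?ler_wpM2r ?(ltW kr)//.
  by rewrite -[`|v|]ofR_rnorm -ofRM absCE ofR_le.
have H : f \o shift x = cst (f x) + L' +o_ 0 id.
  apply/eqaddoP => e /ofR_gt0P[r r0 ->{e}].
  have [d d0 H] := fL _ r0; apply/rnorm_nbhsP; exists d => // h.
  rewrite subr0 => /H; rewrite -[`|id h|]ofR_rnorm -ofRM absCE ofR_le /=.
  by rewrite !fctE /= [h + x]addrC opprD addrA.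
have E := diff_unique Lc H.
by apply/diff_locallyP; rewrite E.
Qed.
End RealNorm.

(** * Integrals of complex functions of a real variable *)

Section Integral.
Context {R : realType}.
Local Notation C := (Cplx R).
Local Notation mu := (@lebesgue_measure R).

Definition rint (a b : R) (f : R -> R) : R := \int[mu]_(x in `[a, b]) f x.

Section Real.
Variables (a b : R) (f : R -> R).
Hypothesis ab : a <= b.
Hypothesis fc : {within `[a, b], continuous f}.

Lemma rint_integrable : mu.-integrable `[a, b] (EFin \o f).
Proof. by apply: continuous_compact_integrable => //; exact: segment_compact. Qed.

Lemma rint_cst k : rint a b (fun=> k) = k * (b - a).
Proof.
rewrite /rint Rintegral_cst//= lebesgue_measure_itv/= lte_fin.
by case: ltgtP ab => // ->; rewrite subrr.
Qed.

Lemma rint_norm_le M : (forall x, a <= x <= b -> `|f x| <= M) ->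
  `|rint a b f| <= M * (b - a).
Proof.
move=> fM; apply: (le_trans (le_normr_Rintegral _ rint_integrable)) => //.
rewrite -rint_cst; apply: le_Rintegral => //.
- exact/integrable_norm/rint_integrable.
- exact/continuous_compact_integrable/continuous_subspaceT/cst_continuous/segment_compact.
Qed.

Lemma rint_ge m : (forall x, a <= x <= b -> m <= f x) ->
  m * (b - a) <= rint a b f.
Proof.
move=> fM; rewrite -rint_cst; apply: le_Rintegral => //.
- exact/continuous_compact_integrable/continuous_subspaceT/cst_continuous/segment_compact.
- exact: rint_integrable.
Qed.

Lemma rint_le m : (forall x, a <= x <= b -> f x <= m) ->
  rint a b f <= m * (b - a).
Proof.
move=> fM; rewrite -rint_cst; apply: le_Rintegral => //.
- exact: rint_integrable.
- exact/continuous_compact_integrable/continuous_subspaceT/cst_continuous/segment_compact.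
Qed.

Lemma rint_split c : a <= c <= b -> rint a b f = rint a c f + rint c b f.
Proof.
move=> /andP[ac cb]; rewrite /rint.
have H := Rintegral_itvB rint_integrable (x := c).
rewrite !bnd_simp in H; move: (H ac cb).
rewrite -(@Rintegral_itv_obnd_cbnd _ c (BRight b)); last first.
  apply: (integrableS _ _ _ rint_integrable) => //.
  by apply: subset_itv; rewrite !bnd_simp.
by move=> <-; rewrite addrC subrK.
Qed.

End Real.

Lemma rintD (a b : R) (f g : R -> R) : {within `[a, b], continuous f} ->
  {within `[a, b], continuous g} ->
  rint a b (fun x => f x + g x) = rint a b f + rint a b g.
Proof. by move=> fc gc; apply: RintegralD => //; exact: rint_integrable. Qed.

Lemma rintZ (a b k : R) (f : R -> R) : {within `[a, b], continuous f} ->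
  rint a b (fun x => k * f x) = k * rint a b f.
Proof. by move=> fc; apply: RintegralZl => //; exact: rint_integrable. Qed.

Lemma eq_rint (a b : R) (f g : R -> R) : (forall x, a <= x <= b -> f x = g x) ->
  rint a b f = rint a b g.
Proof. by move=> fg; apply: eq_Rintegral => x; rewrite inE/= in_itv/=; exact: fg. Qed.

Lemma rint_shift (a b c : R) (f : R -> R) : a <= b ->
  {within `[a + c, b + c], continuous f} ->
  rint (a + c) (b + c) f = rint a b (fun x => f (x + c)).
Proof.
move=> ab fc; pose F (x : R) := x + c.
have dF : (F^`())%classic = cst 1.
  by apply/funext => x; rewrite derive1E deriveD// derive_id derive_cst addr0.
rewrite /rint /Rintegral (@integration_by_substitution_increasing _ F f a b ab).
- by congr fine; apply: eq_integral => x _; rewrite dF /= mulr1.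
- by move=> x y _ _ xy; rewrite ltrD2r.
- by rewrite dF => x _; exact: cvg_cst.
- by rewrite dF; exact: is_cvg_cst.
- by rewrite dF; exact: is_cvg_cst.
- have Fc : continuous F.
    by move=> x; apply: continuousD; [exact: id|exact: cst_continuous].
  split; first by move=> x _; apply: derivableD.
  + exact/cvg_at_right_filter/Fc.
  + exact/cvg_at_left_filter/Fc.
- exact: fc.
Qed.

(** Continuity in the full topology of [R], end points included, is stronger than continuity on the
    segment as a subspace; it is what composition with a function continuous at points of [C] gives
    directly. *)
Definition segcont (a b : R) (f : R -> C) :=
  forall t, a <= t <= b -> {for t, continuous f}.

Lemma complex_Re_continuous : continuous (fun z : C => complex.Re z : R).
Proof.
move=> z; apply/(@cvgrPdist_lt _ R^o _ (nbhs z)) => e e0; apply/rnorm_nbhsP.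
exists e => // w wz; rewrite -cReB (le_lt_trans (Re_le_normc _))//.
by rewrite normc_distC.
Qed.

Lemma complex_Im_continuous : continuous (fun z : C => complex.Im z : R).
Proof.
move=> z; apply/(@cvgrPdist_lt _ R^o _ (nbhs z)) => e e0; apply/rnorm_nbhsP.
exists e => // w wz; rewrite -cImB (le_lt_trans (Im_le_normc _))//.
by rewrite normc_distC.
Qed.

Lemma segcont_Re a b f : segcont a b f ->
  {within `[a, b], continuous (fun t => complex.Re (f t))}.
Proof.
move=> fc; apply: continuous_in_subspaceT => t.
rewrite inE /= in_itv /= => /fc ft.
by apply: continuous_comp ft _; exact: complex_Re_continuous.
Qed.

Lemma segcont_Im a b f : segcont a b f ->
  {within `[a, b], continuous (fun t => complex.Im (f t))}.
Proof.
move=> fc; apply: continuous_in_subspaceT => t.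
rewrite inE /= in_itv /= => /fc ft.
by apply: continuous_comp ft _; exact: complex_Im_continuous.
Qed.

Definition cint (a b : R) (f : R -> C) : C :=
  Complex (rint a b (fun t => complex.Re (f t)))
          (rint a b (fun t => complex.Im (f t))).

Lemma eq_cint a b f g : (forall x, a <= x <= b -> f x = g x) ->
  cint a b f = cint a b g.
Proof.
by move=> fg; congr Complex; apply: eq_rint => x /fg ->.
Qed.

Lemma cint_shift a b c f : a <= b -> segcont (a + c) (b + c) f ->
  cint (a + c) (b + c) f = cint a b (fun t => f (t + c)).
Proof.
move=> ab fc; rewrite /cint !rint_shift//.
- exact: segcont_Im.
- exact: segcont_Re.
Qed.

Lemma cint_split a b c f : a <= c <= b -> segcont a b f ->
  cint a b f = cint a c f + cint c b f.
Proof.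
move=> acb fc; rewrite /cint (rint_split (segcont_Re fc) acb).
by rewrite (rint_split (segcont_Im fc) acb).
Qed.

Lemma cint_cst a b k : a <= b -> cint a b (fun=> k) = k * ofR (b - a).
Proof.
move=> ab; rewrite /cint !rint_cst//.
by apply: ReImP; rewrite ?cReM ?cImM /ofR /= ?mulr0 ?subr0 ?add0r.
Qed.

Lemma cintD a b f g : segcont a b f -> segcont a b g ->
  cint a b (fun t => f t + g t) = cint a b f + cint a b g.
Proof.
move=> fc gc; rewrite /cint -[RHS]/(Complex _ _) -!rintD.
- by congr Complex; apply: eq_rint => x _; rewrite ?cReD ?cImD.
- exact: segcont_Im.
- exact: segcont_Im.
- exact: segcont_Re.
- exact: segcont_Re.
Qed.

Lemma cintZ a b k f : segcont a b f ->
  cint a b (fun t => k * f t) = k * cint a b f.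
Proof.
move=> fc; have fr := segcont_Re fc; have fi := segcont_Im fc.
have Z l (h : R -> R) : {within `[a, b], continuous h} ->
    {within `[a, b], continuous (fun t => l * h t)}.
  by move=> hc x; apply: cvgM; [exact: cvg_cst | exact: hc].
apply: ReImP; rewrite /= ?cReM ?cImM /=.
- rewrite -mulNr -!rintZ// -rintD; [|exact: Z..].
  by apply: eq_rint => x _; rewrite cReM mulNr.
- rewrite -!rintZ// -rintD; [|exact: Z..].
  by apply: eq_rint => x _; rewrite cImM.
Qed.

(** The factor 2 is the price of estimating real and imaginary parts separately; it propagates into
    the 4 and the 16 of the contour estimates. *)
Lemma cint_norm_le a b f M : a <= b -> segcont a b f ->
  (forall x, a <= x <= b -> normc (f x) <= M) ->
  normc (cint a b f) <= M * 2 * (b - a).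
Proof.
move=> ab fc fM; apply: (le_trans (normc_le_ReIm _)).
have -> : M * 2 * (b - a) = M * (b - a) + M * (b - a) by ring.
apply: lerD; apply: rint_norm_le => //.
- exact: segcont_Re.
- by move=> x /fM; apply: le_trans; exact: Re_le_normc.
- exact: segcont_Im.
- by move=> x /fM; apply: le_trans; exact: Im_le_normc.
Qed.

End Integral.

(** * Integrals along rectangles *)

Section Rectangle.
Context {R : realType}.
Local Notation C := (Cplx R).
Implicit Types (f g : C -> C) (x y : R).

Definition cpx x y : C := Complex x y.
Definition ci : C := Complex 0 1.

Lemma cpxE x y : cpx x y = ofR x + ci * ofR y.
Proof. by apply: ReImP; rewrite ?cReD ?cImD ?cReM ?cImM /=; ring. Qed.

Lemma normc_ci : normc ci = 1.
Proof. by rewrite /= expr0n /= add0r expr1n sqrtr1. Qed.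

Definition crect (x0 x1 y0 y1 : R) : set C :=
  [set z | x0 <= complex.Re z <= x1 /\ y0 <= complex.Im z <= y1].

Definition crbd (x0 x1 y0 y1 : R) : set C := crect x0 x1 y0 y1 `&`
  [set z | [\/ complex.Re z = x0, complex.Re z = x1,
              complex.Im z = y0 | complex.Im z = y1]].

(** The contour integral of [f(z) dz], taken counterclockwise; on the vertical sides [dz] is
    [ci dt]. *)
Definition rectint (x0 x1 y0 y1 : R) f : C :=
  cint x0 x1 (fun t => f (cpx t y0)) - cint x0 x1 (fun t => f (cpx t y1))
  + ci * (cint y0 y1 (fun t => f (cpx x1 t)) - cint y0 y1 (fun t => f (cpx x0 t))).

Definition ccont (A : set C) f := forall z, A z -> {for z, continuous f}.

Lemma cpx_continuous_l y : continuous (fun x => cpx x y).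
Proof.
move=> x; apply/cvgrPdist_lt => e /ofR_gt0P[r r0 ->].
apply/nbhs_normP; exists r => //= u ur.
by rewrite absCE ofR_lt /= subrr expr0n /= addr0 sqrtr_sqr.
Qed.

Lemma cpx_continuous_r x : continuous (fun y => cpx x y).
Proof.
move=> y; apply/cvgrPdist_lt => e /ofR_gt0P[r r0 ->].
apply/nbhs_normP; exists r => //= u ur.
by rewrite absCE ofR_lt /= subrr expr0n /= add0r sqrtr_sqr.
Qed.

Lemma segcont_h (A : set C) f (a b y : R) : ccont A f ->
  (forall t, a <= t <= b -> A (cpx t y)) -> segcont a b (fun t => f (cpx t y)).
Proof.
move=> fc H t tab; apply: continuous_comp; first exact: cpx_continuous_l.
exact/fc/H.
Qed.

Lemma segcont_v (A : set C) f (a b x : R) : ccont A f ->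
  (forall t, a <= t <= b -> A (cpx x t)) -> segcont a b (fun t => f (cpx x t)).
Proof.
move=> fc H t tab; apply: continuous_comp; first exact: cpx_continuous_r.
exact/fc/H.
Qed.

Lemma affine_continuous (A B : C) : continuous (fun z : C => A + B * z).
Proof.
move=> z; apply: continuousD; first exact: cst_continuous.
exact: mulrl_continuous.
Qed.

Lemma ccontZ (A : set C) (k : C) f : ccont A f -> ccont A (fun z => k * f z).
Proof.
move=> fc z Az; apply: continuousM; last exact: fc.
exact: cst_continuous.
Qed.

Lemma ccontD (A : set C) f g : ccont A f -> ccont A g ->
  ccont A (fun z => f z + g z).
Proof. by move=> fc gc z Az; apply: continuousD; [exact: fc|exact: gc]. Qed.

Section Fixed.
Variables (x0 x1 y0 y1 : R).
Hypotheses (x01 : x0 <= x1) (y01 : y0 <= y1).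
Local Notation Q := (crbd x0 x1 y0 y1).

Lemma segcont_crect f : ccont Q f ->
  [/\ segcont x0 x1 (fun t => f (cpx t y0)), segcont x0 x1 (fun t => f (cpx t y1)),
      segcont y0 y1 (fun t => f (cpx x1 t)) & segcont y0 y1 (fun t => f (cpx x0 t))].
Proof.
by move=> fc; split; (apply: (segcont_h fc) || apply: (segcont_v fc)) => t tab;
  split; rewrite /crect /= ?tab ?lexx ?x01 ?y01//;
  (by constructor 1) || (by constructor 2) || (by constructor 3) || (by constructor 4).
Qed.

Lemma eq_rectint f g : (forall z, Q z -> f z = g z) ->
  rectint x0 x1 y0 y1 f = rectint x0 x1 y0 y1 g.
Proof.
move=> fg; congr (_ - _ + _ * (_ - _)); apply: eq_cint => t tab; apply: fg;
  split; rewrite /crect /= ?tab ?lexx ?x01 ?y01//;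
  (by constructor 1) || (by constructor 2) || (by constructor 3) || (by constructor 4).
Qed.

Lemma rectint_splitx f m : x0 <= m <= x1 -> ccont Q f ->
  rectint x0 x1 y0 y1 f = rectint x0 m y0 y1 f + rectint m x1 y0 y1 f.
Proof.
move=> xm fc; have [h0 h1 _ _] := segcont_crect fc.
by rewrite /rectint (cint_split xm h0) (cint_split xm h1); ring.
Qed.

Lemma rectint_splity f m : y0 <= m <= y1 -> ccont Q f ->
  rectint x0 x1 y0 y1 f = rectint x0 x1 y0 m f + rectint x0 x1 m y1 f.
Proof.
move=> ym fc; have [_ _ v0 v1] := segcont_crect fc.
by rewrite /rectint (cint_split ym v0) (cint_split ym v1); ring.
Qed.

Lemma rectintD f g : ccont Q f -> ccont Q g ->
  rectint x0 x1 y0 y1 (fun z => f z + g z) =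
  rectint x0 x1 y0 y1 f + rectint x0 x1 y0 y1 g.
Proof.
move=> /segcont_crect[? ? ? ?] /segcont_crect[? ? ? ?].
by rewrite /rectint !cintD//; ring.
Qed.

Lemma rectintZ k f : ccont Q f ->
  rectint x0 x1 y0 y1 (fun z => k * f z) = k * rectint x0 x1 y0 y1 f.
Proof.
by move=> /segcont_crect[? ? ? ?]; rewrite /rectint !cintZ//; ring.
Qed.

(** Only differences between opposite sides count: [B * ci * (y0 - y1)] times the width for the
    horizontal pair, [B * (x1 - x0)] times the height for the vertical one, and the factor [ci] of
    the latter makes them cancel. The integral of [t] itself is never evaluated. *)
Lemma rectint_affine A B : rectint x0 x1 y0 y1 (fun z => A + B * z) = 0.
Proof.
have sc (a b : R) (k : C) : segcont a b (fun=> k) by move=> t _; exact: cvg_cst.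
have sh (a b : R) : segcont a b (fun t => cpx t 0).
  by move=> t _; exact: cpx_continuous_l.
have sv (a b : R) : segcont a b (fun t => cpx 0 t).
  by move=> t _; exact: cpx_continuous_r.
have sm (a b : R) (k : C) h : segcont a b h -> segcont a b (fun t => k * h t).
  by move=> hc t tab; apply: cvgM; [exact: cvg_cst | exact: hc].
have hE y : cint x0 x1 (fun t => A + B * cpx t y) =
    (A + B * (ci * ofR y)) * ofR (x1 - x0) + B * cint x0 x1 (fun t => cpx t 0).
  rewrite -cint_cst// -cintZ// -cintD//; last exact: sm.
  by apply: eq_cint => t _; rewrite !cpxE ofR0; ring.
have vE x : cint y0 y1 (fun t => A + B * cpx x t) =
    (A + B * ofR x) * ofR (y1 - y0) + B * cint y0 y1 (fun t => cpx 0 t).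
  rewrite -cint_cst// -cintZ// -cintD//; last exact: sm.
  by apply: eq_cint => t _; rewrite !cpxE ofR0; ring.
by rewrite /rectint !hE !vE !ofRD !ofRN; ring.
Qed.

Lemma rectint_norm_le f M : ccont Q f ->
  (forall z, Q z -> normc (f z) <= M) ->
  normc (rectint x0 x1 y0 y1 f) <= M * 4 * ((x1 - x0) + (y1 - y0)).
Proof.
move=> /segcont_crect[h0 h1 v1 v0] fM; rewrite /rectint.
apply: le_trans (normcD _ _) _.
have -> : M * 4 * ((x1 - x0) + (y1 - y0)) =
  (M * 2 * (x1 - x0) + M * 2 * (x1 - x0)) +
  (M * 2 * (y1 - y0) + M * 2 * (y1 - y0)) by ring.
rewrite normcM normc_ci mul1r.
by apply: lerD; apply: le_trans (normcB _ _) _; apply: lerD;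
  apply: cint_norm_le => // t tab; apply: fM;
  split; rewrite /crect /= ?tab ?lexx ?x01 ?y01//;
  (by constructor 1) || (by constructor 2) || (by constructor 3) || (by constructor 4).
Qed.

End Fixed.
End Rectangle.

(** * Goursat's theorem *)

(** The pigeonhole principle of Goursat's bisection, with [q = 4 ^+ k] the scaling already
    accumulated: one of four pieces carries at least a quarter of the total. *)
Lemma quarter_le (R : realFieldType) (q K t a b c d : R) :
  0 < q -> K <= q * t -> t <= a + b + (c + d) ->
  [\/ K <= 4 * q * a, K <= 4 * q * b, K <= 4 * q * c | K <= 4 * q * d].
Proof.
move=> q0 Kq tl; have {}Kq : K <= q * a + q * b + (q * c + q * d).
  by rewrite -!mulrDr (le_trans Kq)// ler_pM2l.
have [|Ha] := leP K (4 * q * a); first by constructor 1.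
have [|Hb] := leP K (4 * q * b); first by constructor 2.
have [|Hc] := leP K (4 * q * c); first by constructor 3.
have [|Hd] := leP K (4 * q * d); first by constructor 4.
by move: Kq Ha Hb Hc Hd; rewrite -!mulrA; lra.
Qed.

Section Goursat.
Context {R : realType}.
Local Notation C := (Cplx R).
Variables (x0 x1 y0 y1 : R) (f : C -> C).
Hypotheses (x01 : x0 <= x1) (y01 : y0 <= y1).
Hypothesis fd : forall z, crect x0 x1 y0 y1 z -> differentiable f z.

Let w := x1 - x0.
Let h := y1 - y0.
Let W k := w / 2 ^+ k.
Let H k := h / 2 ^+ k.
Let piece k (p : R * R) := rectint p.1 (p.1 + W k) p.2 (p.2 + H k) f.

(** Here [p] is the lower left corner of a piece of generation [k]. Each bisection keeps at least a
    quarter of the modulus of the integral, so the factor [4 ^+ k] compensates for the loss. *)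
Let good (K : R) k (p : R * R) :=
  [/\ x0 <= p.1, p.1 + W k <= x1, y0 <= p.2, p.2 + H k <= y1 &
      K <= 4 ^+ k * normc (piece k p)].

Let nxt k (p q : R * R) := p.1 <= q.1 <= p.1 + W k.+1 /\
  p.2 <= q.2 <= p.2 + H k.+1.

Let W_ge0 k : 0 <= W k. Proof. by rewrite divr_ge0 ?exprn_ge0// subr_ge0. Qed.
Let H_ge0 k : 0 <= H k. Proof. by rewrite divr_ge0 ?exprn_ge0// subr_ge0. Qed.
Let WS k : W k = W k.+1 + W k.+1.
Proof. by rewrite /W exprS; field; rewrite expf_neq0. Qed.
Let HS k : H k = H k.+1 + H k.+1.
Proof. by rewrite /H exprS; field; rewrite expf_neq0. Qed.

Let cont_sub (a b c d : R) : x0 <= a -> b <= x1 -> y0 <= c -> d <= y1 ->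
  ccont (crbd a b c d) f.
Proof.
move=> xa bx yc dy z [[/andP[az zb] /andP[cz zd]] _].
apply/differentiable_continuous/fd.
by split; apply/andP; split; lra.
Qed.

Let bisect K k p : good K k p -> exists q, good K k.+1 q /\ nxt k p q.
Proof.
case: p => x y [/= xl xr yl yr Kp].
have wk := W_ge0 k.+1; have hk := H_ge0 k.+1; have WSk := WS k; have HSk := HS k.
set w' := W k.+1 in wk WSk *; set h' := H k.+1 in hk HSk *.
pose Q a b := piece k.+1 (a, b).
have split4 : piece k (x, y) =
    Q x y + Q x (y + h') + (Q (x + w') y + Q (x + w') (y + h')).
  rewrite /piece /= (@rectint_splitx _ _ _ _ _ _ _ _ (x + w')); last first.
  - by apply: cont_sub.
  - by apply/andP; split; lra.
  - by lra.
  - by lra.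
  rewrite /Q /piece /= -/w' -/h' WSk HSk [x + (w' + w')]addrA [y + (h' + h')]addrA.
  by congr (_ + _); apply: rectint_splity;
    try solve [lra | apply/andP; split; lra | apply: cont_sub; lra].

have nxtQ a b : (a == x) || (a == x + w') -> (b == y) || (b == y + h') ->
    K <= 4 ^+ k.+1 * normc (Q a b) ->
    exists q, good K k.+1 q /\ nxt k (x, y) q.
  move=> ax by_ KQ; exists (a, b); split; last first.
    rewrite /nxt /= -/w' -/h'.
    by case/orP: ax => /eqP ->; case/orP: by_ => /eqP ->; split; apply/andP; split; lra.
  split; [..|exact: KQ]; rewrite /= -/w' -/h'.
  - by case/orP: ax => /eqP ->; lra.
  - by case/orP: ax => /eqP ->; lra.
  - by case/orP: by_ => /eqP ->; lra.
  - by case/orP: by_ => /eqP ->; lra.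
have T : normc (piece k (x, y)) <= normc (Q x y) + normc (Q x (y + h')) +
    (normc (Q (x + w') y) + normc (Q (x + w') (y + h'))).
  rewrite split4; apply: le_trans (normcD _ _) _.
  by apply: lerD; apply: normcD.
have k4 : 0 < 4 ^+ k :> R by rewrite exprn_gt0.
have [KQ|KQ|KQ|KQ] := quarter_le k4 Kp T; rewrite -exprS in KQ.
- by apply: nxtQ KQ; rewrite eqxx.
- by apply: nxtQ KQ; rewrite eqxx ?orbT.
- by apply: nxtQ KQ; rewrite eqxx ?orbT.
- by apply: nxtQ KQ; rewrite eqxx ?orbT.
Qed.

Theorem goursat : rectint x0 x1 y0 y1 f = 0.
Proof.
apply/eqP; rewrite -normc_eq0 eq_le normc_ge0 andbT.
set K := normc _.
have good0 : good K 0 (x0, y0).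
  rewrite /good /piece /W /H /= expr0 !divr1 mul1r.
  by rewrite /w /h (addrC x0) (addrC y0) !subrK !lexx.
have [u [u0 uS]] : exists u : nat -> R * R, u 0 = (x0, y0) /\
    forall k, good K k (u k) -> good K k.+1 (u k.+1) /\ nxt k (u k) (u k.+1).
  (* The generation is carried along with the corner because the relation depends on it. The
     implication gives every state a successor, whether or not its piece is [good]. *)
  pose r (a b : nat * (R * R)) := b.1 = a.1.+1 /\
    (good K a.1 a.2 -> good K b.1 b.2 /\ nxt a.1 a.2 b.2).
  have [|v [v0 vS]] := @dependent_choice _ r _ (0%N, (x0, y0)).
    move=> [k p]; apply: cid.
    have [gp|gp] := pselect (good K k p).
      by have [q ?] := bisect gp; exists (k.+1, q).
    by exists (k.+1, p).
  have v1 k : (v k).1 = k.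
    by elim: k => [|k IH]; [rewrite v0|rewrite (vS k).1 IH].
  exists (fun k => (v k).2); rewrite v0; split=> // k.
  by have := (vS k).2; rewrite !v1.
have gu k : good K k (u k).
  by elim: k => [|k IH]; [rewrite u0|apply: (uS k IH).1].
have nu k : nxt k (u k) (u k.+1) := (uS k (gu k)).2.
(* Nested intervals, used once for each coordinate: the common point is the supremum of the left end
   points. *)
have lim (a : nat -> R) (V : nat -> R) : (forall k, 0 <= V k) ->
    (forall k, V k = V k.+1 + V k.+1) ->
    (forall k, a k <= a k.+1 <= a k + V k.+1) ->
    exists l, forall k, a k <= l <= a k + V k.
  move=> V0 VS aS.
  have mono m k : a k <= a (k + m)%N /\ a (k + m)%N + V (k + m)%N <= a k + V k.
    elim: m => [|m [IH1 IH2]]; first by rewrite addn0 !lexx.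
    have /andP[s1 s2] := aS (k + m)%N; have := VS (k + m)%N.
    by rewrite addnS; split; lra.
  have ub k m : a m <= a k + V k.
    have [km|/ltnW mk] := leqP k m.
      have [_] := mono (m - k)%N k; rewrite subnKC// => ?.
      by have := V0 m; lra.
    have [+ _] := mono (k - m)%N m; rewrite subnKC// => ?.
    by have := V0 k; lra.
  exists (sup (range a)) => k; apply/andP; split.
    apply: ub_le_sup; last by exists k.
    by exists (a 0%N + V 0%N) => _ [m _ <-].
  by apply: ge_sup; [exists (a 0%N), 0%N|move=> _ [m _ <-]].
have [px Hx] := lim (fun k => (u k).1) W W_ge0 WS (fun k => (nu k).1).
have [py Hy] := lim (fun k => (u k).2) H H_ge0 HS (fun k => (nu k).2).
pose p : C := cpx px py.
have dp : differentiable f p.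
  apply: fd; have := Hx 0%N; have := Hy 0%N; rewrite u0 /W /H expr0 !divr1 /=.
  by rewrite /w /h => /andP[? ?] /andP[? ?]; split; apply/andP; split=> /=; lra.
pose L := w + h.
have L0 : 0 <= L by rewrite addr_ge0// subr_ge0.
apply/ler_addgt0Pr => e e0; rewrite add0r.
(* The final bound is [4 ^+ k] times [e' * (L / 2 ^+ k) * 4 * (L / 2 ^+ k)], that is,
   [4 * L ^+ 2 * e']. The added 1 keeps the denominator positive when the rectangle is a point. *)
pose e' := e / (4 * L ^+ 2 + 1).
have e'0 : 0 < e' by rewrite divr_gt0// ltr_wpDl// mulr_ge0// exprn_ge0.
have [d d0 fdp] := differentiable_approx dp e'0.
have [k kd] : exists k, L / 2 ^+ k < d.
  exists (Num.bound (L / d)); rewrite ltr_pdivrMr ?exprn_gt0// mulrC -ltr_pdivrMr//.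
  apply: (lt_trans (archi_boundP _)); first by rewrite divr_ge0// ltW.
  by rewrite -natrX ltr_nat ltn_expl.
have [xl xr yl yr Kk] := gu k.
(* Subtracting the first-order expansion at [p], an affine function, leaves the contour integral
   unchanged and makes the integrand at most [e'] times the distance to [p]. *)
pose A := f p - 'd f p 1 * p; pose B := 'd f p 1.
have dE (v : C) : 'd f p v = B * v.
  by rewrite /B -{1}[v]mulr1 linearZ /= mulrC.
pose g z := f z - (A + B * z).
have gE : piece k (u k) = rectint (u k).1 ((u k).1 + W k) (u k).2 ((u k).2 + H k) g.
  have WW := W_ge0 k; have HH := H_ge0 k.
  have fcont : ccont (crbd (u k).1 ((u k).1 + W k) (u k).2 ((u k).2 + H k)) f.
    exact: cont_sub.
  have acont : ccont (crbd (u k).1 ((u k).1 + W k) (u k).2 ((u k).2 + H k))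
      (fun z => A + B * z).
    by move=> z _; exact: affine_continuous.
  have wl : (u k).1 <= (u k).1 + W k by rewrite lerDl.
  have hl : (u k).2 <= (u k).2 + H k by rewrite lerDl.
  have E := rectintD wl hl fcont (ccontZ (k := -1) acont).
  rewrite (rectintZ wl hl _ acont) (rectint_affine wl hl) mulr0 addr0 in E.
  rewrite /piece -E; congr rectint; apply/funext => z.
  by rewrite /g mulN1r.
have gc : normc (piece k (u k)) <= (e' * (L / 2 ^+ k)) * 4 * (W k + H k).
  have WW := W_ge0 k; have HH := H_ge0 k.
  rewrite gE; apply: (le_trans (rectint_norm_le _ _ _ _)); rewrite ?lerDl//; last first.
  - by rewrite ![_ + _ - _]addrAC !subrr !add0r.
  - move=> z [[zx zy] _].
    have zp : normc (z - p) <= L / 2 ^+ k.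
      apply: (le_trans (normc_le_ReIm _)); rewrite cReB cImB /L mulrDl.
      have := Hx k; have := Hy k; move: zx zy.
      rewrite -/(W k) -/(H k) /p /=.
      move=> /andP[? ?] /andP[? ?] /andP[? ?] /andP[? ?].
      by apply: lerD; rewrite ler_norml; apply/andP; split; lra.
    have := fdp (z - p); rewrite rnormE => /(_ (le_lt_trans zp kd)).
    rewrite dE [p + _]addrC subrK => fz.
    apply: (@le_trans _ _ (e' * normc (z - p))); last by rewrite ler_wpM2l// ltW.
    by apply: le_trans fz; rewrite le_eqVlt; apply/orP; left; apply/eqP; congr normc;
      rewrite /g /A -/B; ring.
  - move=> z Qz; apply: continuousB; last exact: affine_continuous.
    by apply: cont_sub Qz.
have -> : e = e' * (4 * L ^+ 2 + 1).
  by rewrite /e' divfK// gt_eqF// ltr_wpDl// mulr_ge0// exprn_ge0.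
apply: (le_trans Kk); have k4 : 0 < 4 ^+ k :> R by rewrite exprn_gt0.
apply: (@le_trans _ _ (4 ^+ k * (e' * (L / 2 ^+ k) * 4 * (W k + H k)))).
  by rewrite ler_pM2l.
have -> : 4 ^+ k * (e' * (L / 2 ^+ k) * 4 * (W k + H k)) = e' * (4 * L ^+ 2).
  rewrite /W /H (_ : 4 = 2 * 2 :> R); last by ring.
  by rewrite exprMn -mulrDl -/L; field; rewrite expf_neq0.
by rewrite ler_pM2l// lerDl.
Qed.

End Goursat.

(** * Cauchy's formula and Taylor expansion *)

Section Cauchy.
Context {R : realType}.
Local Notation C := (Cplx R).
Implicit Types (f g : C -> C) (z w p : C).

Lemma differentiable_mul f g z : differentiable f z -> differentiable g z ->
  differentiable (fun z => f z * g z) z.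
Proof. exact: differentiableM. Qed.

Lemma differentiable_kernel w N z : z != 0 -> z != w ->
  differentiable (fun z : C => (z ^+ N * (z - w))^-1) z.
Proof.
move=> z0 zw; apply: (@differentiableV C C (fun z => z ^+ N * (z - w))).
  apply: differentiable_mul; first exact/derivable1_diffP/exprn_derivable.
  by apply: differentiableB.
by rewrite mulf_neq0 ?expf_neq0// subr_eq0.
Qed.

Lemma differentiable_invsub w z : z != w ->
  differentiable (fun z : C => (z - w)^-1) z.
Proof.
move=> zw; apply: (@differentiableV C C (fun z => z - w)).
  by apply: differentiableB.
by rewrite subr_eq0.
Qed.

Lemma differentiable_inv z : z != 0 -> differentiable (fun z : C => z^-1) z.
Proof. by move=> z0; apply: (@differentiableV C C id). Qed.

Section Deform.
Variables (x0 x1 y0 y1 : R) (p : C) (g : C -> C).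
Hypothesis gd : forall z, crect x0 x1 y0 y1 z -> z != p -> differentiable g z.

Let zero (a b c d : R) : x0 <= a -> a <= b -> b <= x1 -> y0 <= c -> c <= d ->
  d <= y1 -> [\/ b < complex.Re p, complex.Re p < a,
    d < complex.Im p | complex.Im p < c] -> rectint a b c d g = 0.
Proof.
move=> xa ab bx yc cd dy H; apply: goursat => // z [/andP[az zb] /andP[cz zd]].
apply: gd; first by split; apply/andP; split; lra.
by apply/eqP => zp; rewrite -zp in H; case: H; lra.
Qed.

Let cont (a b c d : R) : x0 <= a -> b <= x1 -> y0 <= c -> d <= y1 ->
  a < complex.Re p < b -> c < complex.Im p < d -> ccont (crbd a b c d) g.
Proof.
move=> xa bx yc dy /andP[ap pb] /andP[cp pd] z [[/andP[az zb] /andP[cz zd]] H].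
apply/differentiable_continuous/gd; first by split; apply/andP; split; lra.
by apply/eqP => zp; rewrite -zp in ap pb cp pd; case: H; lra.
Qed.

(** Four strips, to the left, to the right, below and above the inner rectangle, are cut off. None
    of them contains [p], so the integral around each vanishes by Goursat's theorem. *)
Lemma rectint_deform (u0 u1 v0 v1 : R) :
  x0 <= u0 -> u1 <= x1 -> y0 <= v0 -> v1 <= y1 ->
  u0 < complex.Re p < u1 -> v0 < complex.Im p < v1 ->
  rectint x0 x1 y0 y1 g = rectint u0 u1 v0 v1 g.
Proof.
move=> xu ux yv vy /andP[up pu] /andP[vp pv].
rewrite (@rectint_splitx _ _ _ _ _ _ _ _ u0); [|lra|lra|apply/andP; split; lra|
  apply: cont; try lra; apply/andP; split; lra].
rewrite zero ?add0r; [|lra..|by constructor 1].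
rewrite (@rectint_splitx _ _ _ _ _ _ _ _ u1); [|lra|lra|apply/andP; split; lra|
  apply: cont; try lra; apply/andP; split; lra].
rewrite [X in _ + X]zero ?addr0; [|lra..|by constructor 2].
rewrite (@rectint_splity _ _ _ _ _ _ _ _ v0); [|lra|lra|apply/andP; split; lra|
  apply: cont; try lra; apply/andP; split; lra].
rewrite zero ?add0r; [|lra..|by constructor 3].
rewrite (@rectint_splity _ _ _ _ _ _ _ _ v1); [|lra|lra|apply/andP; split; lra|
  apply: cont; try lra; apply/andP; split; lra].
by rewrite [X in _ + X]zero ?addr0; [|lra..|by constructor 4].
Qed.

End Deform.

(** Squares of half-side [s] play the role of circles, since Goursat's theorem is available on
    rectangles. *)
Definition sqint w (s : R) f := rectint (complex.Re w - s) (complex.Re w + s)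
  (complex.Im w - s) (complex.Im w + s) f.

Definition sqbd w (s : R) : set C := crbd (complex.Re w - s) (complex.Re w + s)
  (complex.Im w - s) (complex.Im w + s).

Definition csquare w (s : R) : set C := crect (complex.Re w - s) (complex.Re w + s)
  (complex.Im w - s) (complex.Im w + s).

Lemma sqbd_ge w s z : 0 < s -> sqbd w s z -> s <= normc (z - w).
Proof.
move=> s0 [_ H].
have [zw|zw] : `|complex.Re (z - w)| = s \/ `|complex.Im (z - w)| = s.
  rewrite cReB cImB; case: H => ->; [left|left|right|right];
  by rewrite [_ + _ - _]addrAC subrr add0r ?normrN gtr0_norm.
- by rewrite -{1}zw Re_le_normc.
- by rewrite -{1}zw Im_le_normc.
Qed.

Lemma csquare_le w s z : csquare w s z -> normc (z - w) <= 2 * s.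
Proof.
move=> [/andP[a b] /andP[c d]]; apply: (le_trans (normc_le_ReIm _)).
have -> : 2 * s = s + s by ring.
by rewrite cReB cImB; apply: lerD; rewrite ler_norml; apply/andP; split; lra.
Qed.

Lemma sqint_norm_le w s f M : 0 < s -> ccont (sqbd w s) f ->
  (forall z, sqbd w s z -> normc (f z) <= M) ->
  normc (sqint w s f) <= M * 16 * s.
Proof.
move=> s0 fc fM; apply: (le_trans (rectint_norm_le _ _ fc fM)); [lra|lra|].
by rewrite le_eqVlt; apply/orP; left; apply/eqP; ring.
Qed.

Lemma sqint_kernel_shift w s : 0 < s ->
  sqint w s (fun z => (z - w)^-1) = sqint 0 s (fun z => z^-1).
Proof.
move=> s0.
have ss : - s <= s by lra.
have wd z : z != w -> {for z, continuous (fun z : C => (z - w)^-1)}.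
  by move=> zw; exact/differentiable_continuous/differentiable_invsub.
have wc : ccont (sqbd w s) (fun z => (z - w)^-1).
  move=> z /(sqbd_ge s0) zw; apply: wd; apply/eqP => E.
  by move: zw; rewrite E subrr normc0; lra.
have [||h0 h1 v1 v0] := segcont_crect _ _ wc; [lra|lra|].
rewrite /sqint /rectint /= !add0r.
rewrite ![complex.Re w + _]addrC ![complex.Im w + _]addrC in h0 h1 v0 v1 *.
rewrite (cint_shift ss h0) (cint_shift ss h1) (cint_shift ss v1) (cint_shift ss v0).
have sub a b : cpx (a + complex.Re w) (b + complex.Im w) - w = cpx a b.
  by apply: ReImP; rewrite ?cReB ?cImB /= addrK.
by congr (_ - _ + _ * (_ - _)); apply: eq_cint => t _; rewrite sub.
Qed.

(** The true value is 2 pi i, but a distance from 0 is enough. Each side contributes at least 1 to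
    the imaginary part: the density [s / (x ^+ 2 + s ^+ 2)] is at least [1 / (2 * s)], and the side
    has length [2 * s]. *)
Lemma sqint_kernel_ge s : 0 < s -> 4 <= normc (sqint 0 s (fun z => z^-1)).
Proof.
move=> s0; apply: le_trans (Im_le_normc _).
apply: le_trans (ler_norm _).
have wc : ccont (sqbd 0 s) (fun z => z^-1).
  move=> z /(sqbd_ge s0); rewrite subr0 => zs.
  apply: differentiable_continuous; apply: (@differentiableV C C id) => //.
  by apply/eqP => E; move: zs; rewrite E normc0; lra.
have [||h0 h1 v1 v0] := segcont_crect _ _ wc; [lra|lra|].
rewrite /sqint /rectint /= !add0r in h0 h1 v0 v1 *.
have iE x y : (cpx x y)^-1 = cpx (x / (x ^+ 2 + y ^+ 2)) (- (y / (x ^+ 2 + y ^+ 2))).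
  by [].
have ss : - s <= s by lra.
have one : 1 = (2 * s)^-1 * (s - - s).
  by field; rewrite gt_eqF.
have low x : - s <= x <= s -> (2 * s)^-1 <= s / (x ^+ 2 + s ^+ 2).
  move=> /andP[sx xs].
  have xx : 0 <= x ^+ 2 := sqr_ge0 x; have s2 : 0 < s ^+ 2 by rewrite exprn_gt0.
  rewrite ler_pdivlMr; last by rewrite ltr_wpDl.
  rewrite mulrC ler_pdivrMr ?mulr_gt0// mulrCA -expr2.
  have : x ^+ 2 <= s ^+ 2.
    rewrite -real_normK ?num_real// ler_pXn2r ?nnegrE ?(ltW s0)//.
    by rewrite ler_norml sx.
  by lra.
rewrite mul0r add0r mul1r.
have low' x : - s <= x <= s -> - (s / (x ^+ 2 + s ^+ 2)) <= - (2 * s)^-1.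
  by move=> /low; rewrite lerN2.
have h0' : 1 <= rint (- s) s (fun t => - (- s / (t ^+ 2 + (- s) ^+ 2))).
  have H := rint_ge ss (segcont_Im h0) (m := (2 * s)^-1); rewrite -one in H.
  apply: H => x /low.
  by rewrite iE /= mulNr opprK sqrrN.
have h1' : rint (- s) s (fun t => - (s / (t ^+ 2 + s ^+ 2))) <= - 1.
  have H := rint_le ss (segcont_Im h1) (m := - (2 * s)^-1).
  by rewrite mulNr -one in H; apply: H => x /low'.
have v1' : 1 <= rint (- s) s (fun t => s / (s ^+ 2 + t ^+ 2)).
  have H := rint_ge ss (segcont_Re v1) (m := (2 * s)^-1); rewrite -one in H.
  apply: H => x /low.
  by rewrite iE /= [s ^+ 2 + _]addrC.
have v0' : rint (- s) s (fun t => - s / ((- s) ^+ 2 + t ^+ 2)) <= - 1.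
  have H := rint_le ss (segcont_Re v0) (m := - (2 * s)^-1).
  rewrite mulNr -one in H; apply: H => x /low'.
  by rewrite iE /= sqrrN [s ^+ 2 + _]addrC mulNr.
by lra.
Qed.

Lemma sqint_kernel_radius e s : 0 < e -> e <= s ->
  sqint 0 s (fun z => z^-1) = sqint 0 e (fun z => z^-1).
Proof.
move=> e0 es; rewrite /sqint.
have gd z : crect (complex.Re (0 : C) - s) (complex.Re (0 : C) + s)
    (complex.Im (0 : C) - s) (complex.Im (0 : C) + s) z ->
    z != 0 -> differentiable (fun z : C => z^-1) z.
  by move=> _; exact: differentiable_inv.
apply: (rectint_deform gd); rewrite /= ?add0r; try (apply/andP; split); lra.
Qed.

(** The contour shrinks to a small square about [w], on which [f] is almost constant. The integral
    of [1 / z] remains as a factor where 2 pi i would usually stand. *)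
Theorem cauchy_formula s f w : 0 < s ->
  (forall z, csquare 0 s z -> differentiable f z) ->
  normc w < s ->
  f w * sqint 0 s (fun z => z^-1) = sqint 0 s (fun z => f z * (z - w)^-1).
Proof.
move=> s0 fd ws; apply/eqP; rewrite -subr_eq0 -normc_eq0 eq_le normc_ge0 andbT.
apply/ler_addgt0Pr => r r0; rewrite add0r.
have /andP[Rw1 Rw2] : - s < complex.Re w < s.
  by rewrite -ltr_norml (le_lt_trans (Re_le_normc _)).
have /andP[Iw1 Iw2] : - s < complex.Im w < s.
  by rewrite -ltr_norml (le_lt_trans (Im_le_normc _)).
have fdw : differentiable f w.
  by apply: fd; rewrite /csquare /crect /= !add0r; split; apply/andP; split; lra.
have /cvgrPdist_lt/(_ (ofR (r / 16))) := differentiable_continuous fdw.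
rewrite -ofR0 ofR_lt divr_gt0// => /(_ isT) /rnorm_nbhsP[d d0 fw].
(* All points of the small square are within [2 * e < d] of [w], where [f] varies by less than
   [r / 16]; the second bound keeps that square inside the large one. The 16 cancels the one in
   [sqint_norm_le]. *)
pose e := Num.min (d / 4) ((s - normc w) / 2).
have e0 : 0 < e by rewrite lt_min !divr_gt0//; lra.
have ed : 2 * e < d.
  have : e <= d / 4 by rewrite ge_min lexx.
  by lra.
have es : e <= (s - normc w) / 2 by rewrite ge_min lexx orbT.
have /andP[Rw3 Rw4] : - normc w <= complex.Re w <= normc w.
  by rewrite -ler_norml Re_le_normc.
have /andP[Iw3 Iw4] : - normc w <= complex.Im w <= normc w.
  by rewrite -ler_norml Im_le_normc.
have gd z : csquare 0 s z -> z != w ->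
    differentiable (fun z => f z * (z - w)^-1) z.
  move=> sz zw; apply: differentiable_mul; first exact: fd.
  exact: differentiable_invsub.
have small : sqint 0 s (fun z => f z * (z - w)^-1) =
    sqint w e (fun z => f z * (z - w)^-1).
  apply: (rectint_deform gd); rewrite /= ?add0r; try lra; apply/andP; split; lra.
have kernel : sqint 0 s (fun z => z^-1) = sqint w e (fun z => (z - w)^-1).
  rewrite (sqint_kernel_shift w e0); apply: sqint_kernel_radius e0 _.
  by have := normc_ge0 w; lra.
have kc : ccont (sqbd w e) (fun z => (z - w)^-1).
  move=> z /(sqbd_ge e0) zw; apply: differentiable_continuous.
  apply: differentiable_invsub; apply/eqP => E.
  by move: zw; rewrite E subrr normc0; lra.
have sub z : sqbd w e z -> csquare 0 s z.
  move=> [[/andP[? ?] /andP[? ?]] _]; rewrite /csquare /crect /= !add0r.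
  by split; apply/andP; split; lra.
have fc : ccont (sqbd w e) f.
  by move=> z /sub/fd; exact: differentiable_continuous.
have gc : ccont (sqbd w e) (fun z => f z * (z - w)^-1).
  by move=> z ez; apply: continuousM; [exact: fc|exact: kc].
have E : sqint w e (fun z => f z * (z - w)^-1) -
    f w * sqint w e (fun z => (z - w)^-1) =
    sqint w e (fun z => f z * (z - w)^-1 + - f w * (z - w)^-1).
  have l1 : complex.Re w - e <= complex.Re w + e by lra.
  have l2 : complex.Im w - e <= complex.Im w + e by lra.
  rewrite /sqint (rectintD l1 l2 gc (ccontZ kc)) (rectintZ l1 l2 _ kc).
  by rewrite mulNr.
rewrite small kernel normc_distC E.
apply: (@le_trans _ _ (r / 16 / e * 16 * e)); last first.
  by rewrite le_eqVlt; apply/orP; left; apply/eqP; field; rewrite gt_eqF.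
apply: (sqint_norm_le e0 (ccontD gc (ccontZ kc))).
move=> z ez; have ze := sqbd_ge e0 ez.
have fz : normc (f z - f w) <= r / 16.
  have zwd : rnorm (z - w) < d.
    by apply: le_lt_trans (csquare_le _) ed; case: ez.
  by have := fw _ zwd; rewrite absCE ofR_lt normc_distC => /ltW.
rewrite -mulrDl normcM normcV; clear -e0 ze fz.
apply: ler_pM; rewrite ?normc_ge0// ?invr_ge0 ?normc_ge0//.
by rewrite lef_pV2 ?posrE//; exact: lt_le_trans ze.
Qed.

(** The kernel is expanded by finitely many steps of the geometric series, so the remainder is
    itself an integral and no series has to be summed. The constant 8 is 16 from the contour
    estimate, times 2 from [normc (z - w) >= s / 2], divided by the lower bound 4 for the kernel
    integral. *)
Theorem taylor s f M : 0 < s ->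
  (forall z, csquare 0 s z -> differentiable f z) ->
  (forall z, sqbd 0 s z -> normc (f z) <= M) ->
  exists A : nat -> C, forall N w, normc w <= s / 2 ->
    normc (f w - \sum_(k < N) A k * w ^+ k) <= 8 * M * (normc w / s) ^+ N.
Proof.
move=> s0 fd fM.
set K := sqint 0 s (fun z => z^-1).
have K4 : 4 <= normc K := sqint_kernel_ge s0.
have K0 : K != 0 by rewrite -normc_gt0; lra.
pose a k := sqint 0 s (fun z => f z * (z ^+ k.+1)^-1).
exists (fun k => K^-1 * a k) => N w ws.
have bd z : sqbd 0 s z -> s <= normc z.
  by move=> /(sqbd_ge s0); rewrite subr0.
have bd0 z : sqbd 0 s z -> z != 0.
  by move=> /bd; rewrite -normc_gt0; lra.
have bdw z : sqbd 0 s z -> s / 2 <= normc (z - w).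
  move=> /bd zs; have := normcD (z - w) w; rewrite subrK; lra.
have bdw0 z : sqbd 0 s z -> z != w.
  by move=> /bdw; rewrite -subr_eq0 -normc_gt0; lra.
have kc n : ccont (sqbd 0 s) (fun z => f z * (z ^+ n * (z - w))^-1).
  move=> z zs; apply: differentiable_continuous; apply: differentiable_mul.
    by apply: fd; case: zs.
  by apply: differentiable_kernel; [exact: bd0|exact: bdw0].
have ac n : ccont (sqbd 0 s) (fun z => f z * (z ^+ n)^-1).
  move=> z zs; apply: differentiable_continuous; apply: differentiable_mul.
    by apply: fd; case: zs.
  apply: (@differentiableV C C (fun z => z ^+ n)).
    exact/derivable1_diffP/exprn_derivable.
  by rewrite expf_neq0// bd0.
pose I n := sqint 0 s (fun z => f z * (z ^+ n * (z - w))^-1).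
have IS n : I n = a n + w * I n.+1.
  have l : complex.Re (0 : C) - s <= complex.Re (0 : C) + s by rewrite /=; lra.
  have l' : complex.Im (0 : C) - s <= complex.Im (0 : C) + s by rewrite /=; lra.
  rewrite /I /a /sqint -(rectintZ l l' _ (kc _)).
  rewrite -(rectintD l l' (ac _) (ccontZ (kc _))).
  apply: (eq_rectint l l') => z zs; rewrite exprS; field.
  by rewrite subr_eq0 (bdw0 z zs) (bd0 z zs) ?(expf_neq0 n (bd0 z zs)).
have I0 n : f w * K = \sum_(k < n) a k * w ^+ k + w ^+ n * I n.
  elim: n => [|n IH].
    rewrite big_ord0 add0r expr0 mul1r /K cauchy_formula//; last by lra.
    by congr sqint; apply/funext => z; rewrite expr0 mul1r.
  by rewrite big_ord_recr /= IH IS exprS; ring.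
have -> : f w - \sum_(k < N) K^-1 * a k * w ^+ k = K^-1 * (w ^+ N * I N).
  apply: (mulfI K0); rewrite mulrBr mulrA mulfV// mul1r mulrC (I0 N).
  rewrite mulr_sumr addrAC -sumrB big1 ?add0r// => k _.
  by rewrite !mulrA mulfV// mul1r subrr.
have M0 : 0 <= M.
  apply: le_trans (normc_ge0 _) (fM (ofR s) _).
  split; last by constructor 2; rewrite /= add0r.
  by rewrite /crect /= !add0r; split; apply/andP; split; lra.
have IN : normc (I N) <= M * (s ^+ N * (s / 2))^-1 * 16 * s.
  apply: (sqint_norm_le s0 (kc N)) => z zs; rewrite normcM normcV normcM normcX.
  apply: ler_pM; rewrite ?normc_ge0 ?invr_ge0 ?mulr_ge0 ?exprn_ge0 ?normc_ge0//.
    exact: fM.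
  have z0 : 0 < normc z by rewrite normc_gt0 bd0.
  have s2 : 0 < s / 2 by lra.
  have zw := bdw _ zs; have zs' := bd _ zs.
  rewrite lef_pV2; [|by rewrite posrE mulr_gt0 ?exprn_gt0//; lra
                    |by rewrite posrE mulr_gt0 ?exprn_gt0].
  apply: ler_pM zw; rewrite ?exprn_ge0 ?(ltW s0) ?(ltW s2)//.
  by rewrite lerXn2r ?nnegrE ?(ltW s0) ?(ltW z0).
rewrite !normcM normcV normcX expr_div_n.
have KV : (normc K)^-1 <= 4^-1 by rewrite lef_pV2 ?posrE//; lra.
have wN : 0 <= normc w ^+ N by rewrite exprn_ge0// normc_ge0.
apply: (@le_trans _ _ (4^-1 * (normc w ^+ N * (M * (s ^+ N * (s / 2))^-1 * 16 * s)))).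
  apply: ler_pM => //; rewrite ?invr_ge0 ?normc_ge0// ?mulr_ge0 ?normc_ge0//.
  by rewrite ler_wpM2l.
rewrite le_eqVlt; apply/orP; left; apply/eqP; field.
by rewrite expf_neq0 gt_eqF.
Qed.

End Cauchy.

(** * Estimates in a complex normed space *)

Section Estimates.
Context {R : realType}.
Local Notation C := (Cplx R).
Variable V : normedModType C.
Implicit Types (f : V -> C) (a v h x z : V).

Lemma slice_differentiable f a v (w : C) : differentiable f (a + w *: v) ->
  differentiable (fun t : C => f (a + t *: v)) w.
Proof.
by move=> fd; apply: (@differentiable_comp _ _ _ _ (fun t : C => a + t *: v) f) => //.
Qed.

Section Ball.
Variables (f : V -> C) (a : V) (r M : R).
Hypothesis r0 : 0 < r.
Hypothesis fd : forall z, rnorm (z - a) < r -> differentiable f z.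
Hypothesis fM : forall z, rnorm (z - a) < r -> normc (f z) <= M.

Let M0 : 0 <= M.
Proof. by apply: le_trans (normc_ge0 (f a)) (fM _); rewrite subrr rnorm0. Qed.

(** Taylor's formula, to orders 1 and 2, on the complex line through [a] in the direction [v]. The
    factor 2 in the condition on [s] is there because points of the square are only known to have
    modulus at most [2 * s]. The linear coefficient is the differential because both approximate the
    same increment for small parameters. *)
Lemma slice_taylor s v : 0 < s -> 2 * s * rnorm v < r ->
  forall w : C, normc w <= s / 2 ->
    normc (f (a + w *: v) - f a) <= 8 * M * (normc w / s) /\
    normc (f (a + w *: v) - f a - w * 'd f a v) <= 8 * M * (normc w / s) ^+ 2.
Proof.
move=> s0 sv.
have inball (w : C) : csquare 0 s w -> rnorm (a + w *: v - a) < r.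
  move=> /csquare_le; rewrite subr0 addrAC subrr add0r rnormZ => ws.
  by apply: le_lt_trans sv; rewrite ler_wpM2r// rnorm_ge0.
have [|w bw|A AT] := @taylor _ s (fun t : C => f (a + t *: v)) M s0.
- by move=> w cw; apply: slice_differentiable; apply/fd/inball.
- by apply/fM/inball; case: bw.
have s2 : 0 <= s / 2 by lra.
have A0 : f a = A 0%N.
  apply/eqP; rewrite -subr_eq0 -normc_eq0 eq_le normc_ge0 andbT.
  have := AT 1%N 0; rewrite normc0 => /(_ s2).
  by rewrite big_ord1 expr0 mulr1 scale0r addr0 mul0r expr1 mulr0.
have T2 (w : C) : normc w <= s / 2 ->
    normc (f (a + w *: v) - f a - w * A 1%N) <= 8 * M * (normc w / s) ^+ 2.
  move=> /(AT 2%N); rewrite big_ord_recr big_ord1 /= expr0 mulr1 expr1 -A0.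
  by rewrite opprD addrA [A 1%N * w]mulrC.
suff -> : 'd f a v = A 1%N.
  move=> w ws; split; last exact: T2.
  by have := AT 1%N w ws; rewrite big_ord1 expr0 mulr1 expr1 -A0.
apply/eqP; rewrite -subr_eq0 -normc_eq0 eq_le normc_ge0 andbT.
apply/ler_addgt0Pr => e e0; rewrite add0r.
have v1 : 0 < rnorm v + 1 by have := rnorm_ge0 v; lra.
have fda : differentiable f a by apply: fd; rewrite subrr rnorm0.
have e1 : 0 < e / 2 / (rnorm v + 1) by rewrite !divr_gt0.
have [d d0 Hd] := differentiable_approx fda e1.
pose k := 8 * M / s ^+ 2 + 1.
have k0 : 0 < k by rewrite ltr_wpDl// divr_ge0 ?mulr_ge0 ?exprn_ge0 ?(ltW s0).
(* A parameter so small that the quadratic Taylor error and the differentiability error are each at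
   most [t * (e / 2)]. *)
pose t := Num.min (s / 2) (Num.min (d / (rnorm v + 1) / 2) (e / 2 / k)).
have t0 : 0 < t by rewrite !lt_min !divr_gt0.
have ts : t <= s / 2 by rewrite ge_min lexx.
have td : t <= d / (rnorm v + 1) / 2 by rewrite !ge_min lexx orbT.
have tk : t <= e / 2 / k by rewrite !ge_min lexx !orbT.
have nt : normc (ofR t) = t by rewrite normc_ofR gtr0_norm.
have B1 := T2 (ofR t); rewrite nt in B1; have {}B1 := B1 ts.
have tv : rnorm (ofR t *: v) = t * rnorm v by rewrite rnormZ nt.
have tvd : rnorm (ofR t *: v) < d.
  rewrite tv; apply: (@le_lt_trans _ _ (t * (rnorm v + 1))).
    by rewrite ler_wpM2l ?(ltW t0)// lerDl.
  rewrite -ltr_pdivlMr//; apply: le_lt_trans td _.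
  by rewrite ltr_pdivrMr// ltr_pMr ?divr_gt0// ltr1n.
have B2 := Hd _ tvd; rewrite tv linearZ /= in B2.
rewrite -(ler_pM2l t0) -{1}nt -normcM.
have -> : ofR t * ('d f a v - A 1%N) =
   (f (a + ofR t *: v) - f a - ofR t * A 1%N) -
   (f (a + ofR t *: v) - f a - ofR t *: 'd f a v).
  by rewrite -[ofR t *: 'd f a v]/(ofR t * 'd f a v); ring.
apply: le_trans (normcB _ _) _; apply: le_trans (lerD B1 B2) _.
have -> : t * e = t * (e / 2) + t * (e / 2) by field.
apply: lerD.
  have -> : 8 * M * (t / s) ^+ 2 = t * (t * (8 * M / s ^+ 2)).
    by field; rewrite gt_eqF.
  rewrite ler_pM2l//; apply: (@le_trans _ _ (t * k)).
    by rewrite ler_pM2l// /k lerDl.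
  by rewrite -ler_pdivlMr.
have -> : e / 2 / (rnorm v + 1) * (t * rnorm v) =
    t * (e / 2 * (rnorm v / (rnorm v + 1))) by field; rewrite gt_eqF.
rewrite ler_pM2l// ler_piMr//; first by lra.
by rewrite ler_pdivrMr// mul1r lerDl.
Qed.

(** Take direction [h], parameter 1 and [s = r / (4 * rnorm h)] in [slice_taylor]: the condition
    [1 <= s / 2] becomes [rnorm h <= r / 8], and [8 * M / s] gives the constant 32. The same choice
    with [s ^+ 2] gives the 128 of [quadratic_ball]. *)
Lemma lipschitz_ball h : rnorm h <= r / 8 ->
  normc (f (a + h) - f a) <= 32 * M / r * rnorm h.
Proof.
move=> hr; have [->|h0] := eqVneq h 0.
  by rewrite addr0 subrr normc0 rnorm0 mulr0.
have nh : 0 < rnorm h by rewrite lt_neqAle eq_sym rnorm_eq0 h0 rnorm_ge0.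
have s0 : 0 < r / (4 * rnorm h) by rewrite divr_gt0// mulr_gt0.
have E : 2 * (r / (4 * rnorm h)) * rnorm h = r / 2 by field; rewrite gt_eqF.
have [||+ _] := @slice_taylor _ h s0 _ 1.
- by rewrite E; lra.
- rewrite normc1 -mulrA -invfM ler_pdivlMr ?mulr_gt0// mul1r; lra.
rewrite scale1r normc1 => /le_trans; apply.
by rewrite le_eqVlt; apply/orP; left; apply/eqP; field; rewrite !gt_eqF.
Qed.

Lemma quadratic_ball h : rnorm h <= r / 8 ->
  normc (f (a + h) - f a - 'd f a h) <= 128 * M / r ^+ 2 * rnorm h ^+ 2.
Proof.
move=> hr; have [->|h0] := eqVneq h 0.
  by rewrite addr0 subrr linear0 subrr normc0 rnorm0 expr0n mulr0.
have nh : 0 < rnorm h by rewrite lt_neqAle eq_sym rnorm_eq0 h0 rnorm_ge0.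
have s0 : 0 < r / (4 * rnorm h) by rewrite divr_gt0// mulr_gt0.
have E : 2 * (r / (4 * rnorm h)) * rnorm h = r / 2 by field; rewrite gt_eqF.
have [||_ +] := @slice_taylor _ h s0 _ 1.
- by rewrite E; lra.
- rewrite normc1 -mulrA -invfM ler_pdivlMr ?mulr_gt0// mul1r; lra.
rewrite scale1r normc1 mul1r => /le_trans; apply.
by rewrite le_eqVlt; apply/orP; left; apply/eqP; field; rewrite !gt_eqF.
Qed.

(** At the parameter [s / 2] the increment is at most [4 * M] and its deviation from the linear term
    at most [2 * M], so the linear term is at most [6 * M]; with [s = r / (4 * rnorm v)] this
    becomes 48. *)
Lemma cauchy_estimate v : normc ('d f a v) <= 48 * M / r * rnorm v.
Proof.
have [->|v0] := eqVneq v 0; first by rewrite linear0 normc0 rnorm0 mulr0.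
have nv : 0 < rnorm v by rewrite lt_neqAle eq_sym rnorm_eq0 v0 rnorm_ge0.
have [s sE] : exists s, s = r / (4 * rnorm v) by eexists.
have s0 : 0 < s by rewrite sE divr_gt0// mulr_gt0.
have s2 : 0 < s / 2 by lra.
have E : 2 * s * rnorm v = r / 2 by rewrite sE; field; rewrite gt_eqF.
have sr : 2 * s * rnorm v < r by rewrite E ltr_pdivrMr// ltr_pMr// ltr1n.
have ns : normc (ofR (s / 2)) = s / 2 by rewrite normc_ofR gtr0_norm// divr_gt0.
have := slice_taylor s0 sr (w := ofR (s / 2)); rewrite ns => /(_ (lexx _)).
have -> : s / 2 / s = 1 / 2 by field; rewrite gt_eqF.
set P := f _ - f a; move=> [B1 B2].
have : normc (ofR (s / 2) * 'd f a v) <= 6 * M.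
  have -> : ofR (s / 2) * 'd f a v = P - (P - ofR (s / 2) * 'd f a v) by ring.
  apply: le_trans (normcB _ _) _; apply: le_trans (lerD B1 B2) _.
  by rewrite le_eqVlt; apply/orP; left; apply/eqP; field.
rewrite normcM ns -ler_pdivlMl// => /le_trans; apply.
by rewrite le_eqVlt; apply/orP; left; apply/eqP; rewrite sE; field; rewrite !gt_eqF.
Qed.

End Ball.
End Estimates.

(** * Hurwitz's theorem *)

Section Hurwitz.
Context {R : realType}.
Local Notation C := (Cplx R).

Lemma csquare_sub (s t : R) (w : C) : t <= s -> csquare 0 t w -> csquare 0 s w.
Proof.
rewrite /csquare /crect /= !add0r => ts [/andP[? ?] /andP[? ?]].
by split; apply/andP; split; lra.
Qed.

(* Near [0] the first nonzero Taylor term dominates the remainder. *)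
Lemma isolated_zero (h : C -> C) (s M : R) (A : nat -> C) : 0 < s -> 0 <= M ->
  (forall N (w : C), normc w <= s / 2 ->
    normc (h w - \sum_(k < N) A k * w ^+ k) <= 8 * M * (normc w / s) ^+ N) ->
  (exists k, A k != 0) ->
  exists t m : R, [/\ 0 < t, t <= s, 0 < m &
    forall w, sqbd 0 t w -> m <= normc (h w)].
Proof.
move=> s0 M0 HT exA.
case: (ex_minnP exA) => p Ap minp.
have k0 : 0 < normc (A p) by rewrite normc_gt0.
set k := normc (A p) in k0.
(* On the boundary of the square [normc w] lies between [t] and [2 * t], so the remainder is at most
   [normc w ^+ p * (t * c)]. The choice of [t] makes this at most half of the leading term. *)
pose c := 8 * M * 2 / s ^+ p.+1 + 1.
have c0 : 0 < c by rewrite ltr_wpDl// divr_ge0 ?mulr_ge0 ?exprn_ge0 ?(ltW s0).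
pose t := Num.min (s / 4) (k / 2 / c).
have t0 : 0 < t by rewrite lt_min !divr_gt0.
have ts : t <= s / 4 by rewrite ge_min lexx.
have tk : t * c <= k / 2 by rewrite -ler_pdivlMr// ge_min lexx orbT.
exists t, (t ^+ p * (k / 2)); split => //; first by lra.
  by rewrite mulr_gt0 ?exprn_gt0 ?divr_gt0.
move=> w wt.
have tw : t <= normc w by have := sqbd_ge t0 wt; rewrite subr0.
have w2 : normc w <= 2 * t.
  by case: wt => /csquare_le; rewrite subr0.
have := HT p.+1 w; rewrite big_ord_recr /= big1 ?add0r => [|i _]; last first.
  have /eqP -> : A i == 0.
    by apply: contraTT (ltn_ord i) => Ai; rewrite -leqNgt minp.
  by rewrite mul0r.
have ws : normc w <= s / 2 by lra.
move=> /(_ ws) Hw.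
have Bw : 8 * M * (normc w / s) ^+ p.+1 <= normc w ^+ p * (k / 2).
  have -> : 8 * M * (normc w / s) ^+ p.+1 =
      normc w ^+ p * (normc w * (8 * M / s ^+ p.+1)).
    by rewrite expr_div_n [normc w ^+ p.+1]exprS; ring.
  apply: ler_wpM2l; first by rewrite exprn_ge0// normc_ge0.
  apply: le_trans tk; apply: (@le_trans _ _ (2 * t * (8 * M / s ^+ p.+1))).
    by apply: ler_wpM2r w2; rewrite divr_ge0 ?mulr_ge0 ?exprn_ge0 ?(ltW s0).
  have -> : 2 * t * (8 * M / s ^+ p.+1) = t * (8 * M * 2 / s ^+ p.+1) by ring.
  by rewrite ler_pM2l// lerDl.
have : normc (A p * w ^+ p) <= normc (h w) + normc (h w - A p * w ^+ p).
  by rewrite -[in X in X <= _](subKr (h w) (A p * w ^+ p)) normcB.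
rewrite normcM normcX -/k => H.
have tp : t ^+ p * (k / 2) <= normc w ^+ p * (k / 2).
  apply: ler_wpM2r; first by rewrite divr_ge0// ltW.
  by rewrite lerXn2r ?nnegrE ?normc_ge0// ltW.
apply: (le_trans tp).
have : normc w ^+ p * k - normc w ^+ p * (k / 2) <= normc (h w).
  by rewrite mulrC; lra.
by apply: le_trans; rewrite le_eqVlt; apply/orP; left; apply/eqP; field.
Qed.

(** If all Taylor coefficients of [h] vanish, so does [h], as the remainder decays like [2 ^- N].
    Otherwise [m <= normc (h w)] around a small square, whence the reciprocal of some [h_ j] is at
    most [2 / m] there. The Taylor estimate with [N = 0] is a maximum principle with constant 8, so
    this reciprocal is at most [16 / m] at 0, whereas [normc (h_ j 0) <= m / 32]. *)
Lemma hurwitz (F : set_system nat) (PF : ProperFilter F) (h_ : nat -> C -> C)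
    (h : C -> C) (s M : R) : 0 < s ->
  (forall w, csquare 0 s w -> differentiable h w) ->
  (forall w, csquare 0 s w -> normc (h w) <= M) ->
  F [set j | forall w, csquare 0 s w -> differentiable (h_ j) w /\ h_ j w != 0] ->
  (forall e : R, 0 < e ->
     F [set j | forall w, csquare 0 s w -> normc (h_ j w - h w) <= e]) ->
  h 0 = 0 -> forall w, normc w <= s / 2 -> h w = 0.
Proof.
move=> s0 hd hM Fd Fu h0 w ws.
have c0 t : 0 <= t -> csquare 0 t (0 : C).
  by move=> t0; rewrite /csquare /crect /= !add0r; split; apply/andP; split; lra.
have M0 : 0 <= M := le_trans (normc_ge0 _) (hM 0 (c0 s (ltW s0))).
have [A HA] := taylor s0 hd (fun z (zs : sqbd 0 s z) => hM z zs.1).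
have [exA|nA] := pselect (exists k, A k != 0); last first.
  have A0 k : A k = 0 by apply: contrapT => Ak; apply: nA; exists k; exact/eqP.
  apply/eqP; rewrite -normc_eq0 eq_le normc_ge0 andbT leNgt; apply/negP => hw.
  have [N NB] : exists N : nat, 8 * M / normc (h w) < 2 ^+ N.
    exists (Num.bound (8 * M / normc (h w))).
    apply: (lt_trans (archi_boundP _)); first by rewrite divr_ge0 ?mulr_ge0 ?normc_ge0.
    by rewrite -natrX ltr_nat ltn_expl.
  have := HA N w ws; rewrite big1 ?subr0; last by move=> k _; rewrite A0 mul0r.
  apply/negP; rewrite -ltNge; apply: (@le_lt_trans _ _ (8 * M * (1 / 2) ^+ N)).
    apply: ler_wpM2l; first by rewrite mulr_ge0.
    rewrite lerXn2r ?nnegrE ?divr_ge0 ?normc_ge0 ?(ltW s0)//.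
    by rewrite ler_pdivrMr//; lra.
  rewrite expr_div_n expr1n mul1r ltr_pdivrMr ?exprn_gt0// [_ * 2 ^+ N]mulrC.
  by rewrite -ltr_pdivrMr.
have [t [m [t0 ts m0 hm]]] := isolated_zero s0 M0 HA exA.
have m32 : 0 < m / 32 by lra.
have [j [/= jd ju]] := filter_ex (filterI Fd (Fu _ m32)).
have sub := fun w => @csquare_sub s t w ts.
have jm z : sqbd 0 t z -> normc (h_ j z)^-1 <= 2 / m.
  move=> zt; have zs : csquare 0 s z by apply: sub; case: zt.
  have : normc (h z) <= normc (h_ j z) + normc (h_ j z - h z).
    rewrite -[in X in X <= _](subKr (h_ j z) (h z)); exact: normcB.
  have := ju z zs; have := hm z zt => a b c.
  rewrite normcV -[2 / m]invf_div lef_pV2 ?posrE ?divr_gt0//; first by lra.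
  by rewrite normc_gt0; exact: (jd z zs).2.
have jinv z : csquare 0 t z -> differentiable (fun z => (h_ j z)^-1) z.
  by move=> /sub /jd[? ?]; exact: differentiableV.
have [B HB] := taylor t0 jinv jm.
exfalso; have := HB 0%N 0; rewrite normc0 big_ord0 subr0 expr0 mulr1 normcV.
have t2 : 0 <= t / 2 by lra.
move=> /(_ t2); apply/negP; rewrite -ltNge.
have s00 := c0 s (ltW s0).
have := ju 0 s00; rewrite h0 subr0 => j0.
have j00 : 0 < normc (h_ j 0) by rewrite normc_gt0; exact: (jd 0 s00).2.
apply: (@lt_le_trans _ _ (m / 32)^-1); last by rewrite lef_pV2 ?posrE.
rewrite invf_div mulrA ltr_pM2r ?invr_gt0//.
by lra.
Qed.

Lemma csquare_compact (w : C) (s : R) : compact (csquare w s).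
Proof.
have -> : csquare w s = (fun p : R * R => cpx p.1 p.2) @`
   (`[complex.Re w - s, complex.Re w + s] `*` `[complex.Im w - s, complex.Im w + s]).
  apply/seteqP; split=> [z [zx zy]|_ [[x y] [/= xs ys] <-]].
    exists (complex.Re z, complex.Im z); last by case: z {zx zy}.
    by split; rewrite /= in_itv.
  by split; rewrite /=; rewrite in_itv in xs ys.
apply: continuous_compact; last first.
  by apply: compact_setX; exact: segment_compact.
apply: continuous_subspaceT => -[x y].
apply/cvgrPdist_lt => e /ofR_gt0P[r r0 ->].
have r2 : 0 < r / 2 by lra.
exists (ball x (r / 2), ball y (r / 2)) => /=.
  by split; exact: nbhsx_ballx.
move=> [u v] [/= xu yv]; rewrite absCE ofR_lt.
apply: (le_lt_trans (normc_le_ReIm _)); rewrite cReB cImB /=.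
move: xu yv; rewrite -!ball_normE /= => xu yv.
by rewrite (splitr r) ltrD.
Qed.

End Hurwitz.

(** * Limits along ultrafilters *)

Section FilterLimit.
Context {R : realType}.
Local Notation C := (Cplx R).
Variable F : set_system nat.

Definition flim (a : nat -> C) (l : C) :=
  forall e : R, 0 < e -> F [set j | normc (a j - l) <= e].

Section Proper.
Context {PF : ProperFilter F}.
Implicit Types (a b : nat -> C) (l m : C).

Lemma flim_le a l (B : R) : flim a l -> F [set j | normc (a j) <= B] ->
  normc l <= B.
Proof.
move=> al aB; apply/ler_addgt0Pr => e e0.
have [j [/= h1 h2]] := filter_ex (filterI (al e e0) aB).
rewrite -[l](subKr (a j)); apply: (le_trans (normcB _ _)).
by rewrite lerD.
Qed.

Lemma flimD a b l m : flim a l -> flim b m -> flim (fun j => a j + b j) (l + m).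
Proof.
move=> al bm e e0; have e2 : 0 < e / 2 by lra.
apply: filterS (filterI (al _ e2) (bm _ e2)) => j [/= h1 h2].
have -> : a j + b j - (l + m) = (a j - l) + (b j - m) by ring.
by apply: (le_trans (normcD _ _)); rewrite (splitr e) lerD.
Qed.

Lemma flimZ k a l : flim a l -> flim (fun j => k * a j) (k * l).
Proof.
move=> al e e0; have k1 : 0 < normc k + 1 by have := normc_ge0 k; lra.
apply: filterS (al _ (divr_gt0 e0 k1)) => j /= h.
rewrite -mulrBr normcM (@le_trans _ _ ((normc k + 1) * normc (a j - l)))//.
  by rewrite ler_wpM2r ?normc_ge0// lerDl.
by rewrite mulrC -ler_pdivlMr.
Qed.

Lemma flimB a b l m : flim a l -> flim b m -> flim (fun j => a j - b j) (l - m).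
Proof.
move=> al bm; have := flimD al (flimZ (-1) bm).
rewrite mulN1r; congr flim; apply/funext => j; by rewrite mulN1r.
Qed.

Lemma flim_uniq a l m : flim a l -> flim a m -> l = m.
Proof.
move=> al am; apply/eqP; rewrite -subr_eq0 -normc_eq0 eq_le normc_ge0 andbT.
apply: (flim_le (flimB al am)); apply: filterE => j /=.
by rewrite subrr normc0.
Qed.

End Proper.

Section Ultra.
Context {UF : UltraFilter F}.

(** The limit is the supremum of the numbers below [a j] for [F]-almost all [j]. Nothing larger has
    this property, and an ultrafilter then contains the complementary set, which is the upper
    estimate. *)
Lemma ultra_real_limit (a : nat -> R) (K : R) : F [set j | `|a j| <= K] ->
  exists l, forall e : R, 0 < e -> F [set j | `|a j - l| <= e].
Proof.
move=> aK; pose S := [set t | F [set j | t <= a j]].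
have supS : has_sup S.
  split.
    by exists (- K); apply: filterS aK => j /=; rewrite ler_norml => /andP[].
  exists K => t /= St; have [j [/= h1 h2]] := filter_ex (filterI aK St).
  by move: h1; rewrite ler_norml => /andP[_]; exact: le_trans.
exists (sup S) => e e0.
have [t St te] := sup_adherent e0 supS.
have nS : F (~` [set j | sup S + e <= a j]).
  have [Se|//] := in_ultra_setVsetC [set j | sup S + e <= a j] UF.
  have : sup S + e <= sup S by apply: ub_le_sup => //; case: supS.
  by rewrite gerDl leNgt e0.
apply: filterS (filterI St nS) => j [/= h1 /negP]; rewrite -ltNge => h2.
by rewrite ler_norml; apply/andP; split; lra.
Qed.

Lemma ultra_limit (a : nat -> C) (K : R) : F [set j | normc (a j) <= K] ->
  exists l, flim a l.
Proof.
move=> aK.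
have [|l1 H1] := @ultra_real_limit (fun j => complex.Re (a j)) K.
  by apply: filterS aK => j /=; apply: le_trans; exact: Re_le_normc.
have [|l2 H2] := @ultra_real_limit (fun j => complex.Im (a j)) K.
  by apply: filterS aK => j /=; apply: le_trans; exact: Im_le_normc.
exists (cpx l1 l2) => e e0; have e2 : 0 < e / 2 by lra.
apply: filterS (filterI (H1 _ e2) (H2 _ e2)) => j [/= h1 h2].
apply: (le_trans (normc_le_ReIm _)); rewrite cReB cImB /=.
by rewrite (splitr e) lerD.
Qed.

End Ultra.

End FilterLimit.

Section CompactUniform.
Context {R : realType}.
Variables (V : normedModType (Cplx R)) (F : set_system nat).
Context {FF : Filter F}.

Lemma compact_uniform (K : set V) (P : nat -> V -> Prop) : compact K ->
  (forall x, K x -> exists2 d : R, 0 < d &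
     F [set j | forall z, rnorm (z - x) < d -> P j z]) ->
  F [set j | forall z, K z -> P j z].
Proof.
move=> /compact_near_coveringP cK H; apply: cK => x /H[d d0 Fd].
exists ([set z | rnorm (z - x) < d], [set j | forall z, rnorm (z - x) < d -> P j z]).
  by split => //; apply/rnorm_nbhsP; exists d.
by move=> [z j] [/= zx]; apply.
Qed.

End CompactUniform.

(** * Limits of locally bounded holomorphic functions *)

Section LocallyBounded.
Context {R : realType}.
Local Notation C := (Cplx R).
Variables (V : normedModType C) (F : set_system nat).
Context {UF : UltraFilter F}.

Variables (f_ : nat -> V -> C) (x : V) (r K : R) (u : V -> C).
Hypothesis r0 : 0 < r.
Hypothesis fK : F [set j | forall z, rnorm (z - x) < r ->
  differentiable (f_ j) z /\ normc (f_ j z) <= K].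
Hypothesis fu : forall z, rnorm (z - x) < r -> flim F (fun j => f_ j z) (u z).

Let xx : rnorm (x - x) < r. Proof. by rewrite subrr rnorm0. Qed.

Let xr z : rnorm (z - x) <= r / 8 -> rnorm (z - x) < r.
Proof. by move=> h; apply: (le_lt_trans h); rewrite gtr_pMr// invf_lt1// ltr1n. Qed.

Let f_lipschitz : F [set j | forall z, rnorm (z - x) <= r / 8 ->
  normc (f_ j z - f_ j x) <= 32 * K / r * rnorm (z - x)].
Proof.
apply: filterS fK => j /= jK z zx.
have := @lipschitz_ball _ _ (f_ j) x r K r0 (fun z h => (jK z h).1)
  (fun z h => (jK z h).2) _ zx.
by rewrite [x + _]addrC subrK.
Qed.

Lemma limit_lipschitz z : rnorm (z - x) <= r / 8 ->
  normc (u z - u x) <= 32 * K / r * rnorm (z - x).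
Proof.
move=> zx; apply: (flim_le (flimB (fu (xr zx)) (fu xx))).
by apply: filterS f_lipschitz => j; apply.
Qed.

(** Locally bounded holomorphic functions are equi-Lipschitz near [x], and so is their limit;
    convergence at the single point [x] then controls a whole neighbourhood, with an error [e / 3]
    from each of three terms. *)
Lemma limit_locally_uniform e : 0 < e -> exists2 d : R, 0 < d &
  F [set j | forall z, rnorm (z - x) < d -> normc (f_ j z - u z) <= e].
Proof.
move=> e0.
have K0 : 0 <= K.
  have [j jK] := filter_ex fK.
  exact: le_trans (normc_ge0 _) (jK x xx).2.
pose L := 32 * K / r + 1.
have L0 : 0 < L by rewrite ltr_wpDl// divr_ge0 ?mulr_ge0// ltW.
pose d := Num.min (r / 8) (e / 3 / L).
have e3 : 0 < e / 3 by lra.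
exists d; first by rewrite lt_min !divr_gt0.
apply: filterS (filterI f_lipschitz (fu xx e3)) => j [/= jl jx] z zd.
have zr : rnorm (z - x) <= r / 8 by rewrite (le_trans (ltW zd))// ge_min lexx.
have zL : 32 * K / r * rnorm (z - x) <= e / 3.
  apply: (@le_trans _ _ (L * rnorm (z - x))).
    by rewrite ler_wpM2r ?rnorm_ge0// lerDl.
  rewrite mulrC -ler_pdivlMr// (le_trans (ltW zd))//.
  by rewrite ge_min lexx orbT.
have -> : f_ j z - u z = (f_ j z - f_ j x) + ((f_ j x - u x) - (u z - u x)) by ring.
have h1 := le_trans (jl z zr) zL; have h2 := le_trans (limit_lipschitz zr) zL.
apply: (le_trans (normcD _ _)).
have -> : e = e / 3 + (e / 3 + e / 3) by field.
by apply: (lerD h1); apply: (le_trans (normcB _ _)); exact: lerD.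
Qed.

(* The derivatives of the [f_ j] at [x] converge pointwise along [F], and the
   second-order estimate is uniform in [j], so it passes to the limit. *)
Lemma limit_differentiable : differentiable u x.
Proof.
have dK v : F [set j | normc ('d (f_ j) x v) <= 48 * K / r * rnorm v].
  apply: filterS fK => j jK.
  exact: (@cauchy_estimate _ _ (f_ j) x r K r0 (fun z h => (jK z h).1)
    (fun z h => (jK z h).2)).
have [L HL] := choice (fun v => ultra_limit (dK v)).
have K0 : 0 <= K.
  have [j jK] := filter_ex fK.
  exact: le_trans (normc_ge0 _) (jK x xx).2.
have Ll : linear L.
  move=> k v w; apply: flim_uniq (HL (k *: v + w)) _.
  have -> : (fun j => 'd (f_ j) x (k *: v + w)) =
      (fun j => k * 'd (f_ j) x v + 'd (f_ j) x w).
    by apply/funext => j; rewrite linearP.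
  exact: flimD (flimZ k (HL v)) (HL w).
apply: (approx_differentiable Ll (k := 48 * K / r)) => [v|e e0].
  exact: flim_le (HL v) (dK v).
pose c := 128 * K / r ^+ 2 + 1.
have c0 : 0 < c by rewrite ltr_wpDl// divr_ge0 ?mulr_ge0 ?exprn_ge0// ltW.
exists (Num.min (r / 8) (e / c)); first by rewrite lt_min !divr_gt0.
move=> h; rewrite lt_min => /andP[hr he].
have hx : rnorm (x + h - x) <= r / 8 by rewrite [x + h]addrC addrK ltW.
apply: (@le_trans _ _ (128 * K / r ^+ 2 * rnorm h ^+ 2)).
  apply: flim_le (flimB (flimB (fu (xr hx)) (fu xx)) (HL h)) _.
  apply: filterS fK => j jK.
  exact: (@quadratic_ball _ _ (f_ j) x r K r0 (fun z h => (jK z h).1)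
    (fun z h => (jK z h).2) _ (ltW hr)).
rewrite expr2 mulrA ler_wpM2r ?rnorm_ge0//.
apply: (@le_trans _ _ (c * rnorm h)).
  by rewrite ler_wpM2r ?rnorm_ge0// lerDl.
by rewrite mulrC -ler_pdivlMr// ltW.
Qed.

End LocallyBounded.

(** * The spherical derivative and a coordinate on the Riemann sphere *)

Section Spherical.
Context {R : realType}.
Local Notation C := (Cplx R).
Variable V : normedModType C.

(** Up to an affine change this is the height of [c] on the Riemann sphere. It extends by 0 to
    infinity, and this one coordinate is enough to tell bounded values from large ones. *)
Definition chordal (c : C) : R := (1 + normc c ^+ 2)^-1.

Lemma real_is_derive (a : R -> R) (t l : R) :
  (forall e : R, 0 < e -> exists2 d : R, 0 < d & forall h, `|h| < d ->
    `|a (t + h) - a t - h * l| <= e * `|h|) ->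
  is_derive t 1 a l.
Proof.
move=> H.
have cv : h^-1 *: (a (h *: 1 + t) - a t) @[h --> 0^'] --> l.
  apply/cvgrPdist_le => e e0; have [d d0 Hd] := H e e0.
  apply/nbhs_normP; exists d => //= h hd h0.
  have hd' : `|h| < d by move: hd; rewrite /ball_ /= sub0r normrN.
  have := Hd h hd'; rewrite -[h *: 1]/(h * 1) mulr1 [h + t]addrC => Hh.
  rewrite -[_ *: _]/(_ * _) distrC.
  have -> : h^-1 * (a (t + h) - a t) - l = h^-1 * (a (t + h) - a t - h * l).
    by field.
  rewrite normrM normfV mulrC ler_pdivrMr ?normr_gt0//.
by apply: DeriveDef; [apply/cvg_ex; exists l | apply: cvg_lim].
Qed.

Lemma slice_real_derive (f : V -> C) (x v : V) (t : R) :
  differentiable f (x + ofR t *: v) ->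
  is_derive t 1 (fun t => complex.Re (f (x + ofR t *: v)))
    (complex.Re ('d f (x + ofR t *: v) v)) /\
  is_derive t 1 (fun t => complex.Im (f (x + ofR t *: v)))
    (complex.Im ('d f (x + ofR t *: v) v)).
Proof.
move=> fd.
have v1 : 0 < rnorm v + 1 by have := rnorm_ge0 v; lra.
have key e : 0 < e -> exists2 d : R, 0 < d & forall h, `|h| < d ->
    normc (f (x + ofR (t + h) *: v) - f (x + ofR t *: v) -
      ofR h * 'd f (x + ofR t *: v) v) <= e * `|h|.
  move=> e0; have [d d0 Hd] := differentiable_approx fd (divr_gt0 e0 v1).
  exists (d / (rnorm v + 1)); first by rewrite divr_gt0.
  move=> h hd; have nh : rnorm (ofR h *: v) = `|h| * rnorm v.
    by rewrite rnormZ normc_ofR.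
  have hv : `|h| * rnorm v <= `|h| * (rnorm v + 1) by rewrite ler_wpM2l// lerDl.
  have hd' : rnorm (ofR h *: v) < d.
    by rewrite nh (le_lt_trans hv)// -ltr_pdivlMr.
  have := Hd _ hd'; rewrite -[x + _ + ofR h *: v]addrA -scalerDl -ofRD linearZ nh => /le_trans.
  apply; rewrite -mulrA ler_pM2l// mulrC ler_pdivrMr//.
split; apply: real_is_derive => e /key[d d0 Hd]; exists d => // h /Hd;
  apply: le_trans.
- by apply: le_trans (Re_le_normc _); rewrite !cReB cReM /= mul0r subr0.
- by apply: le_trans (Im_le_normc _); rewrite !cImB cImM /= mul0r addr0.
Qed.

(** The mean value theorem along the segment. With [n] the modulus of the value, the derivative of
    the height is at most [2 * n * normc (D c) / (1 + n ^+ 2) ^+ 2] by Cauchy-Schwarz, and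
    [2 * n <= 1 + n ^+ 2] leaves the spherical derivative. *)
Lemma chordal_lipschitz (f : V -> C) (x v : V) (M : R) :
  (forall t : R, 0 <= t <= 1 -> differentiable f (x + ofR t *: v) /\
    normc ('d f (x + ofR t *: v) v) <= M * (1 + normc (f (x + ofR t *: v)) ^+ 2)) ->
  `|chordal (f (x + v)) - chordal (f x)| <= M.
Proof.
move=> H.
pose a (t : R) := complex.Re (f (x + ofR t *: v)).
pose b (t : R) := complex.Im (f (x + ofR t *: v)).
pose D (t : R) := 'd f (x + ofR t *: v) v.
pose psi (t : R) := (1 + (a t ^+ 2 + b t ^+ 2))^-1.
have psiE (t : R) : psi t = chordal (f (x + ofR t *: v)).
  by rewrite /psi /chordal normc_sqr.
have pos (t : R) : 0 < 1 + (a t ^+ 2 + b t ^+ 2).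
  by rewrite ltr_wpDr// addr_ge0// sqr_ge0.
pose dpsi (t : R) := - (2 * (a t * complex.Re (D t) + b t * complex.Im (D t))) /
   (1 + (a t ^+ 2 + b t ^+ 2)) ^+ 2.
have dp (t : R) : 0 <= t <= 1 -> is_derive t 1 psi (dpsi t).
  move=> /H[/slice_real_derive[da db] _].
  pose g := cst 1 + (a ^+ 2 + b ^+ 2).
  have gE y : g y = 1 + (a y ^+ 2 + b y ^+ 2) by [].
  have dg : is_derive t 1 g
      (2 * (a t * complex.Re (D t) + b t * complex.Im (D t))).
    have := is_deriveD (is_derive_cst (1 : R) t 1)
      (is_deriveD (is_deriveX 2 da) (is_deriveX 2 db)).
    move=> /is_derive_eq; apply; rewrite -/(a t) -/(b t) -/(D t) /= !expr1 add0r.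
    by rewrite -![(_ * _) *: _]/(_ * _ * _); ring.
  have g0 : g t != 0 by rewrite gE gt_eqF.
  have [g1 g2] := dg.
  apply: DeriveDef; first exact: (derivableV g0 g1).
  by rewrite (deriveV g0 g1) g2 -[_ *: _]/(_ * _) /dpsi gE !mulNr; congr (- _); rewrite mulrC.
have [||c c01] := @MVT_segment R psi dpsi 0 1 ler01.
- by move=> t; rewrite in_itv /= => /andP[t0 t1]; apply: dp; rewrite !ltW.
- apply: continuous_in_subspaceT => t; rewrite inE /= in_itv /= => t01.
  have [dt _] := dp t t01.
  exact/differentiable_continuous/derivable1_diffP.
rewrite !psiE subr0 mulr1 ofR1 ofR0 scale1r scale0r addr0 => ->.
have [_ dM] := H c c01.
rewrite /dpsi normrM normrN normfV normrX.
have -> : 1 + (a c ^+ 2 + b c ^+ 2) = 1 + normc (f (x + ofR c *: v)) ^+ 2.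
  by rewrite normc_sqr.
set w := f (x + ofR c *: v) in dM *; set n := normc w in dM *.
have n2 : 0 < 1 + n ^+ 2 by rewrite ltr_wpDr// sqr_ge0.
rewrite gtr0_norm// ler_pdivrMr ?exprn_gt0//.
have Dn : normc (D c) <= M * (1 + n ^+ 2) := dM.
have cs : `|2 * (a c * complex.Re (D c) + b c * complex.Im (D c))| <=
    2 * n * normc (D c).
  have : `|complex.Re (w^*%C * D c)| <= n * normc (D c).
    apply: le_trans (Re_le_normc _) _.
    by rewrite normcM /n; case: (w) => p q /=; rewrite sqrrN.
  rewrite normrM gtr0_norm// -mulrA ler_pM2l// cReM.
  rewrite /a /b -/w; case: (w) => p q /=.
  by rewrite mulNr opprK.
apply: (le_trans cs).
have n1 : 2 * n <= 1 + n ^+ 2 by have := sqr_ge0 (1 - n); rewrite sqrrB; lra.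
have n0 : 0 <= n := normc_ge0 _.
apply: (@le_trans _ _ ((1 + n ^+ 2) * (M * (1 + n ^+ 2)))).
  by apply: ler_pM => //; rewrite ?mulr_ge0 ?normc_ge0.
by rewrite expr2 mulrCA mulrA.
Qed.

End Spherical.

(** * Marty's criterion *)

Section Marty.
Context {R : realType}.
Local Notation C := (Cplx R).
Variables (V : normedModType C) (F : set_system nat).
Context {UF : UltraFilter F}.
Variables (U : set V) (f_ : nat -> V -> C).
Hypothesis U_open : forall x, U x -> exists2 r : R, 0 < r &
  forall z, rnorm (z - x) < r -> U z.
Hypothesis U_star : forall x (t : R), U x -> 0 <= t <= 1 -> U (ofR t *: x).
Hypothesis spherical_bound : forall x, U x -> exists r M : R,
  [/\ 0 < r, 0 < M & F [set j | forall z, rnorm (z - x) < r ->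
    differentiable (f_ j) z /\
    forall v, normc ('d (f_ j) z v) <= M * rnorm v * (1 + normc (f_ j z) ^+ 2)]].

(** For an ultrafilter the negation means that the values at [x] tend to infinity, so each point is
    of exactly one of two kinds. *)
Let fin x := exists K : R, F [set j | normc (f_ j x) <= K].

Let not_fin x (K : R) : ~ fin x -> F [set j | K < normc (f_ j x)].
Proof.
move=> nf; have [FK|] := in_ultra_setVsetC [set j | normc (f_ j x) <= K] UF.
  by exfalso; apply: nf; exists K.
by apply: filterS => j /= /negP; rewrite -ltNge.
Qed.

Let inf_not_fin x : (forall K : R, F [set j | K < normc (f_ j x)]) -> ~ fin x.
Proof.
move=> H [K FK]; have [j [/= h1]] := filter_ex (filterI (H K) FK).
by rewrite leNgt h1.
Qed.

Let chordal_near x : U x -> exists r M : R,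
  [/\ 0 < r, 0 < M & F [set j | forall z, rnorm (z - x) < r ->
    differentiable (f_ j) z /\
    `|chordal (f_ j z) - chordal (f_ j x)| <= M * rnorm (z - x)]].
Proof.
move=> /spherical_bound[r [M [r0 M0 Fr]]]; exists r, M; split => //.
apply: filterS Fr => j Hj z zx; split; first exact: (Hj z zx).1.
rewrite -{1}[z](subrK x) [_ - x + x]addrC.
apply: chordal_lipschitz => t /andP[t0 t1].
have tz : rnorm (x + ofR t *: (z - x) - x) < r.
  rewrite addrAC subrr add0r rnormZ normc_ofR ger0_norm//.
  by apply: le_lt_trans zx; rewrite ler_piMl// rnorm_ge0.
by have [h1 h2] := Hj _ tz; split.
Qed.

(** The chordal height at [x] is at least [c], and on a small ball it changes by at most [c / 2]. A
    height bounded below bounds the modulus, by [2 / c]. *)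
Let fin_bounded x : U x -> fin x -> exists r K : R, 0 < r /\
  F [set j | forall z, rnorm (z - x) < r ->
    differentiable (f_ j) z /\ normc (f_ j z) <= K].
Proof.
move=> /chordal_near[r [M [r0 M0 Fr]]] [K FK].
pose c := (1 + K ^+ 2)^-1.
have K2 : 0 < 1 + K ^+ 2 by rewrite ltr_wpDr// sqr_ge0.
have c0 : 0 < c by rewrite invr_gt0.
exists (Num.min r (c / 2 / M)), (2 / c); split; first by rewrite lt_min r0 !divr_gt0.
apply: filterS (filterI Fr FK) => j [/= jr jK] z.
rewrite lt_min => /andP[zr zc]; have [dz Lz] := jr z zr; split => //.
have cx : c <= chordal (f_ j x).
  rewrite lef_pV2 ?posrE//; last by rewrite ltr_wpDr// sqr_ge0.
  by rewrite lerD2l ler_pXn2r ?nnegrE ?normc_ge0// (le_trans _ jK)// normc_ge0.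
have zc' : M * rnorm (z - x) <= c / 2 by rewrite mulrC -ler_pdivlMr// ltW.
have cz : c / 2 <= chordal (f_ j z).
  by move: Lz; rewrite ler_norml => /andP[? ?]; lra.
have n2 : 0 < 1 + normc (f_ j z) ^+ 2 by rewrite ltr_wpDr// sqr_ge0.
have : 1 + normc (f_ j z) ^+ 2 <= 2 / c.
  by rewrite -invf_div -[leLHS]invrK lef_pV2 ?posrE ?invr_gt0 ?divr_gt0.
by apply: le_trans; have := sqr_ge0 (1 - normc (f_ j z)); rewrite sqrrB; 
  have := normc_ge0 (f_ j z); lra.
Qed.

(** A modulus above 2 means a height at most 1/4; on a small ball the height stays at most 1/2,
    which means a modulus at least 1. *)
Let inf_bounded x : U x -> ~ fin x -> exists2 r : R, 0 < r &
  F [set j | forall z, rnorm (z - x) < r ->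
    [/\ differentiable (f_ j) z, f_ j z != 0 & normc (f_ j z)^-1 <= 1]].
Proof.
move=> /chordal_near[r [M [r0 M0 Fr]]] /(not_fin 2) F2.
have M4 : 0 < 4^-1 / M by rewrite divr_gt0.
exists (Num.min r (4^-1 / M)); first by rewrite lt_min r0.
apply: filterS (filterI Fr F2) => j [/= jr j2] z.
rewrite lt_min => /andP[zr zc]; have [dz Lz] := jr z zr.
have cx : chordal (f_ j x) <= 4^-1.
  rewrite lef_pV2 ?posrE//; last by rewrite ltr_wpDr// sqr_ge0.
  apply: (@le_trans _ _ (2 ^+ 2)); first by lra.
  rewrite (@le_trans _ _ (normc (f_ j x) ^+ 2)) ?lerDr//.
  by rewrite ler_pXn2r ?nnegrE ?normc_ge0// ltW.
have zc' : M * rnorm (z - x) <= 4^-1 by rewrite mulrC -ler_pdivlMr// ltW.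
have cz : chordal (f_ j z) <= 2^-1.
  by move: Lz; rewrite ler_norml => /andP[? ?]; lra.
have n2 : 0 < 1 + normc (f_ j z) ^+ 2 by rewrite ltr_wpDr// sqr_ge0.
have n1 : 1 <= normc (f_ j z).
  have : 2 <= 1 + normc (f_ j z) ^+ 2 by rewrite -lef_pV2 ?posrE.
  by rewrite -(@ler_pXn2r _ 2) ?nnegrE ?normc_ge0// expr1n; lra.
split => //; first by rewrite -normc_gt0; lra.
by rewrite normcV invf_le1//; lra.
Qed.

(** Near an infinite point the reciprocals are bounded and free of zeros, as Hurwitz's theorem
    requires, and the zeros of their limit are exactly the infinite points. *)
Let reciprocal_limit x : U x -> ~ fin x -> exists (r : R) (u : V -> C),
  [/\ 0 < r,
   F [set j | forall z, rnorm (z - x) < r ->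
     [/\ differentiable (fun z => (f_ j z)^-1) z, (f_ j z)^-1 != 0 &
         normc (f_ j z)^-1 <= 1]],
   forall z, rnorm (z - x) < r -> flim F (fun j => (f_ j z)^-1) (u z) &
   forall z, rnorm (z - x) < r -> (u z = 0 <-> ~ fin z)].
Proof.
move=> Ux /(inf_bounded Ux)[r r0 Fr].
have /choice[u Hu] : forall z, exists l, rnorm (z - x) < r ->
    flim F (fun j => (f_ j z)^-1) l.
  move=> z; have [zr|nzr] := pselect (rnorm (z - x) < r); last by exists 0.
  have [|l Hl] := @ultra_limit _ F _ (fun j => (f_ j z)^-1) 1; last by exists l.
  by apply: filterS Fr => j /(_ z zr)[].
exists r, u; split => //.
  apply: filterS Fr => j jr z /jr[dz nz bz]; split => //.
    exact: differentiableV.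
  by rewrite invr_neq0.
move=> z zr; split=> [uz|nf].
  apply: inf_not_fin => K.
  have K0 : 0 < (`|K| + 1)^-1 by rewrite invr_gt0 ltr_wpDl.
  have K1 : 0 < (`|K| + 1)^-1 / 2 by rewrite divr_gt0.
  have := Hu z zr _ K1; rewrite uz => FK.
  apply: filterS (filterI Fr FK) => j [/= jr]; rewrite subr0 => jK.
  have [_ nz _] := jr z zr; have n0 : 0 < normc (f_ j z) by rewrite normc_gt0.
  have : (normc (f_ j z))^-1 < (`|K| + 1)^-1.
    by rewrite -normcV; apply: (le_lt_trans jK); lra.
  rewrite ltf_pV2 ?posrE ?ltr_wpDl// => H; apply: le_lt_trans (ler_norm K) _.
  by lra.
apply/eqP; rewrite -normc_eq0 eq_le normc_ge0 andbT.
apply/ler_addgt0Pr => e e0; rewrite add0r.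
apply: (flim_le (Hu z zr)).
apply: filterS (not_fin e^-1 nf) => j /= jK.
rewrite normcV -[e]invrK lef_pV2 ?posrE ?invr_gt0//; first exact: ltW.
by apply: lt_trans jK; rewrite invr_gt0.
Qed.

(** Hurwitz's theorem on the complex line through [x] and [z], parametrized so that they sit at 0
    and 1: the limit of the reciprocals vanishes at 0, hence at 1. The square has half-side 2
    because the conclusion reaches half as far, and [r / 16] keeps its image within [r / 2] of
    [x]. *)
Let inf_open x : U x -> ~ fin x -> exists2 r : R, 0 < r &
  forall z, rnorm (z - x) < r -> ~ fin z.
Proof.
move=> Ux nf; have [r [u [r0 Fr Hu uP]]] := reciprocal_limit Ux nf.
exists (r / 16); first by lra.
move=> z zx; have zr : rnorm (z - x) < r by lra.
apply/(uP z zr).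
pose v := z - x; pose phi (w : C) := u (x + w *: v).
have inball (w : C) : csquare 0 2 w -> rnorm (x + w *: v - x) < r / 2.
  move=> /csquare_le; rewrite subr0 addrAC subrr add0r rnormZ => w4.
  apply: (@le_lt_trans _ _ (2 * 2 * rnorm v)); first by rewrite ler_wpM2r ?rnorm_ge0.
  by move: zx; rewrite -/v; lra.
have sub y y' : rnorm (y - x) < r / 2 -> rnorm (y' - y) < r / 2 -> rnorm (y' - x) < r.
  move=> h1 h2; rewrite -(subrK y y') -addrA.
  by apply: (le_lt_trans (rnormD _ _)); lra.
have half z' : rnorm (z' - x) < r / 2 -> rnorm (z' - x) < r by move=> *; lra.
have r2 : 0 < r / 2 by lra.
have locb y : rnorm (y - x) < r / 2 -> F [set j | forall z', rnorm (z' - y) < r / 2 ->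
    differentiable (fun z => (f_ j z)^-1) z' /\ normc (f_ j z')^-1 <= 1].
  move=> yx; apply: filterS Fr => j jr z' zy.
  by have [? _ ?] := jr z' (sub _ _ yx zy).
have locu y : rnorm (y - x) < r / 2 -> forall z', rnorm (z' - y) < r / 2 ->
    flim F (fun j => (f_ j z')^-1) (u z').
  by move=> yx z' zy; apply: Hu; exact: sub zy.
have -> : z = x + (1 : C) *: v by rewrite scale1r /v addrC subrK.
rewrite -/(phi 1).
have s2 : 0 < 2 :> R by [].
apply: (@hurwitz _ F _ (fun j w => (f_ j (x + w *: v))^-1) phi 2 1 s2).
- move=> w cw; apply: slice_differentiable.
  exact: (limit_differentiable r2 (locb _ (inball w cw)) (locu _ (inball w cw))).
- move=> w cw; have wr := half _ (inball w cw); apply: flim_le (Hu _ wr) _.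
  by apply: filterS Fr => j /(_ _ wr)[].
- apply: filterS Fr => j jr w cw; have [d nz _] := jr _ (half _ (inball w cw)).
  by split=> //; exact: (@slice_differentiable _ _ (fun z => (f_ j z)^-1)).
- move=> e e0; apply: compact_uniform; first exact: csquare_compact.
  move=> w cw; have wr := inball w cw.
  have [d d0 Hd] := limit_locally_uniform r2 (locb _ wr) (locu _ wr) e0.
  have v1 : 0 < rnorm v + 1 by have := rnorm_ge0 v; lra.
  exists (d / (rnorm v + 1)); first by rewrite divr_gt0.
  apply: filterS Hd => j jd w'; rewrite rnormE => ww; apply: jd.
  rewrite opprD addrACA subrr add0r -scalerBl rnormZ.
  apply: (@le_lt_trans _ _ (normc (w' - w) * (rnorm v + 1))).
    by rewrite ler_wpM2l ?normc_ge0// lerDl.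
  by rewrite -ltr_pdivlMr.
- rewrite /phi scale0r addr0; apply/uP => //.
  by rewrite subrr rnorm0.
- by rewrite normc1 divff.
Qed.

Let fin_open x : U x -> fin x -> exists2 r : R, 0 < r &
  forall z, rnorm (z - x) < r -> fin z.
Proof.
move=> Ux /(fin_bounded Ux)[r [K [r0 Fr]]]; exists r => // z zr; exists K.
by apply: filterS Fr => j /(_ z zr)[].
Qed.

(** Both kinds of points form open sets, so the indicator of [fin] is continuous along the segment
    from 0 to [x]; a change of kind would force it to take the value 1/2. *)
Let fin_const x : U x -> fin x <-> fin 0.
Proof.
move=> Ux; pose chi (t : R) : R := if `[< fin (ofR t *: x) >] then 1 else 0.
have x1 : 0 < rnorm x + 1 by have := rnorm_ge0 x; lra.
have loc (t : R) : 0 <= t <= 1 -> exists2 d : R, 0 < d & forall s, `|s - t| < d ->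
    chi s = chi t.
  move=> t01; have Ut := U_star Ux t01.
  have [r r0 Hr] : exists2 r : R, 0 < r & forall z, rnorm (z - ofR t *: x) < r ->
      (fin z <-> fin (ofR t *: x)).
    have [ft|nft] := pselect (fin (ofR t *: x)).
      by have [r r0 Hr] := fin_open Ut ft; exists r => // z /Hr.
    by have [r r0 Hr] := inf_open Ut nft; exists r => // z /Hr.
  exists (r / (rnorm x + 1)); first by rewrite divr_gt0.
  move=> s st; rewrite /chi; congr (if _ then _ else _).
  apply/asbool_equiv_eq/Hr.
  rewrite -scalerBl -ofRN -ofRD rnormZ normc_ofR.
  apply: (@le_lt_trans _ _ (`|s - t| * (rnorm x + 1))).
    by rewrite ler_wpM2l// lerDl.
  by rewrite -ltr_pdivlMr.
have chi_cont : {within `[0, 1], continuous chi}.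
  apply: continuous_in_subspaceT => t; rewrite inE /= in_itv /= => /loc[d d0 Hd].
  apply/cvgrPdist_lt => e e0; apply/nbhs_normP; exists d => //= s.
  by rewrite /ball_ /= distrC => /Hd ->; rewrite subrr normr0.
have chiE t : chi t = 1 \/ chi t = 0.
  by rewrite /chi; case: ifP => _; [left|right].
have E : chi 0 = chi 1.
  apply: contrapT => ne.
  have [|c _ cE] := @IVT _ chi 0 1 (1 / 2) ler01 chi_cont.
    have [h0|h0] := chiE 0; have [h1|h1] := chiE 1; try by rewrite h0 h1 in ne.
    - by rewrite h0 h1 ge_min le_max; apply/andP; split; apply/orP; [right|left]; lra.
    - by rewrite h0 h1 ge_min le_max; apply/andP; split; apply/orP; [left|right]; lra.
  by have [|] := chiE c => h; rewrite h in cE; lra.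
move: E; rewrite /chi ofR0 ofR1 scale0r scale1r.
case: ifP => /asboolP h0; case: ifP => /asboolP h1 // /eqP;
  by rewrite ?oner_eq0 // eq_sym oner_eq0.
Qed.

(** The kind of the point 0 decides. If it is finite, the functions are locally bounded everywhere;
    if not, the limit of the reciprocals vanishes identically and the convergence to it is locally
    uniform. *)
Theorem marty_ultra :
  (exists u : V -> C, (forall x, U x -> differentiable u x) /\
    forall x, U x -> forall e : R, 0 < e -> exists2 d : R, 0 < d &
      F [set j | forall z, rnorm (z - x) < d -> normc (f_ j z - u z) <= e]) \/
  (forall x, U x -> forall K : R, exists2 d : R, 0 < d &
      F [set j | forall z, rnorm (z - x) < d -> K < normc (f_ j z)]).
Proof.
have [f0|nf0] := pselect (fin 0); [left|right].
  have fU x : U x -> fin x by move=> Ux; apply/(fin_const Ux).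
  have /choice[u Hu] : forall x, exists l, U x -> flim F (fun j => f_ j x) l.
    move=> x; have [Ux|nUx] := pselect (U x); last by exists 0.
    by have [K FK] := fU x Ux; have [l Hl] := ultra_limit FK; exists l.
  have loc x : U x -> exists r K : R, [/\ 0 < r,
      F [set j | forall z, rnorm (z - x) < r ->
         differentiable (f_ j) z /\ normc (f_ j z) <= K] &
      forall z, rnorm (z - x) < r -> flim F (fun j => f_ j z) (u z)].
    move=> Ux; have [r [K [r0 Fr]]] := fin_bounded Ux (fU x Ux).
    have [r' r'0 Hr'] := U_open Ux.
    exists (Num.min r r'), K; split; first by rewrite lt_min r0.
      by apply: filterS Fr => j jr z; rewrite lt_min => /andP[/jr].
    by move=> z; rewrite lt_min => /andP[_ /Hr']; exact: Hu.
  exists u; split=> [x /loc[r [K [r0 Fr ur]]]|x /loc[r [K [r0 Fr ur]]] e e0].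
    exact: limit_differentiable r0 Fr ur.
  exact: limit_locally_uniform r0 Fr ur e e0.
have nfU x : U x -> ~ fin x by move=> Ux /(fin_const Ux).
move=> x Ux K; have [r [u [r0 Fr ur uP]]] := reciprocal_limit Ux (nfU x Ux).
have [r' r'0 Hr'] := U_open Ux.
have Fr' : F [set j | forall z, rnorm (z - x) < r ->
    differentiable (fun z => (f_ j z)^-1) z /\ normc (f_ j z)^-1 <= 1].
  by apply: filterS Fr => j jr z /jr[].
have K0 : 0 < (`|K| + 1)^-1 by rewrite invr_gt0 ltr_wpDl.
have [d d0 Hd] := limit_locally_uniform r0 Fr' ur K0.
exists (Num.min r (Num.min r' d)); first by rewrite !lt_min r0 r'0.
apply: filterS (filterI Fr Hd) => j [/= jr jd] z.
rewrite !lt_min => /and3P[zr zr' zd].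
have uz : u z = 0 by apply/(uP z zr)/nfU/Hr'.
have := jd z zd; rewrite uz subr0 normcV.
have [_ nz _] := jr z zr.
have n0 : 0 < normc (f_ j z) by rewrite normc_gt0 -invr_eq0.
rewrite lef_pV2 ?posrE ?ltr_wpDl// => H.
by apply: le_lt_trans (ler_norm K) _; apply: lt_le_trans H; rewrite ltrDl.
Qed.

End Marty.

(** * Normal families in the ball *)

Section Subsequences.
Context {R : realType}.
Local Notation C := (Cplx R).

(** Since [F] refines [\oo], its members contain arbitrarily large indices, so a [j] with [P m j]
    can always be chosen beyond the previous one. *)
Lemma extract_subsequence (F : set_system nat) (P : nat -> nat -> Prop) :
  ProperFilter F -> \oo `<=` F -> (forall m, F [set j | P m j]) ->
  exists phi : nat -> nat, increasing_seq phi /\ forall m, P m (phi m).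
Proof.
move=> PF Foo FP.
have ex m k : exists j, (k < j)%N /\ P m j.
  have Fk : F [set j | (k < j)%N] by apply: Foo; exists k.+1.
  by have [j [/= ? ?]] := filter_ex (filterI Fk (FP m)); exists j.
have [g Hg] := choice (fun mk : nat * nat => ex mk.1 mk.2).
pose phi := fix phi m := if m is m'.+1 then g (m, phi m') else g (0%N, 0%N).
exists phi; split; first by apply/increasing_seqP => m; exact: (Hg (m.+1, phi m)).1.
by case=> [|m]; [exact: (Hg (0%N, 0%N)).2 | exact: (Hg (m.+1, phi m)).2].
Qed.

Lemma uniform_cvgP (V : normedModType C) (K : set V) (f_ : nat -> V -> C)
    (g : V -> C) :
  (forall e : R, 0 < e -> \forall j \near \oo, forall z, K z ->
     normc (f_ j z - g z) <= e) ->
  {uniform K, f_ @ \oo --> g}.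
Proof.
move=> H A /uniform_nbhs[E [entE EA]].
move: entE; rewrite -entourage_ballE => -[e /= /ofR_gt0P[r r0 ->] eE].
have r2 : 0 < r / 2 by lra.
have := H _ r2; apply: filterS => j Hj; apply: EA => z Kz; apply: eE => /=.
rewrite rnorm_ball rnormE normc_distC.
by apply: le_lt_trans (Hj z Kz) _; lra.
Qed.

Section Exhaustion.
Variables (V : normedModType C) (U : set V) (K_ : nat -> set V).
Hypothesis K_compact : forall m, compact (K_ m).
Hypothesis K_sub : forall m, K_ m `<=` U.
Hypothesis K_exhaust : forall x, U x -> exists2 d : R, 0 < d &
  \forall m \near \oo, forall z, rnorm (z - x) < d -> K_ m z.

Lemma compact_in_exhaustion (K : set V) : compact K -> K `<=` U ->
  \forall m \near \oo, K `<=` K_ m.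
Proof.
move=> cK KU; have := @compact_uniform _ _ \oo _ K (fun m z => K_ m z) cK.
by apply => x /KU /K_exhaust.
Qed.

Lemma cvg_loc_unif_exhaustion (f_ : nat -> V -> C) (g : V -> C) (K : set V) :
  (forall m z, K_ m z -> normc (f_ m z - g z) <= m.+1%:R^-1) ->
  compact K -> K `<=` U -> {uniform K, f_ @ \oo --> g}.
Proof.
move=> fg cK KU; apply: uniform_cvgP => e e0.
have Ke := compact_in_exhaustion cK KU.
have me : \forall m \near \oo, m.+1%:R^-1 <= e.
  near=> m; apply: ltW; near: m; exact: near_infty_natSinv_lt (PosNum e0).
by apply: filterS2 Ke me => m Km me' z /Km /fg /le_trans; apply.
Unshelve. all: by end_near. Qed.

End Exhaustion.

End Subsequences.

(** * Euclidean balls and boxes in the space of row vectors *)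

Section RowVectors.
Context {R : realType} {n : nat}.
Local Notation C := (Cplx R).
Local Notation Cn := 'rV[C]_n.
Implicit Types (z w : Cn).

(** The squared Euclidean norm describes the balls without square roots, while the topology and the
    estimates use the sup norm [rnorm]. *)
Definition esq z : R := \sum_(i < n) normc (z ord0 i) ^+ 2.

Lemma esq_ge0 z : 0 <= esq z.
Proof. by apply: sumr_ge0 => i _; rewrite sqr_ge0. Qed.

Lemma enorm_ltE z (r : R) : 0 < r -> (enorm z < r) = (esq z < r ^+ 2).
Proof.
move=> r0; rewrite /enorm -/(esq z) -{1}[r]gtr0_norm// -sqrtr_sqr.
by rewrite ltr_sqrt// exprn_gt0.
Qed.

Lemma unit_ballE z : unit_ball R n z <-> esq z < 1.
Proof. by rewrite /unit_ball /= enorm_ltE// expr1n. Qed.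

Lemma coord_le_rnorm z i : normc (z ord0 i) <= rnorm z.
Proof.
rewrite -ofR_le -absCE ofR_rnorm.
have -> : `|z| = mx_norm z by [].
rewrite mx_normE -[leLHS]nngE num_le.
by apply/bigmax_geP; right => /=; exists (ord0, i).
Qed.

Lemma rnorm_le z (c : R) : 0 <= c -> (forall i, normc (z ord0 i) <= c) ->
  rnorm z <= c.
Proof.
move=> c0 zc; have -> : rnorm z = complex.Re (mx_norm z) by [].
have [/eqP|] := boolP (mx_norm z == 0); first by move=> ->.
by move=> /mx_norm_neq0[[i j] ->] /=; rewrite ord1; exact: zc.
Qed.

Lemma rnorm_esq_le z : esq z <= 1 -> rnorm z <= 1.
Proof.
move=> z1; apply: rnorm_le => // i.
rewrite -(@ler_pXn2r _ 2) ?nnegrE ?normc_ge0// expr1n (le_trans _ z1)//.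
rewrite /esq (bigD1 i)//= lerDl; apply: sumr_ge0 => k _.
by rewrite sqr_ge0.
Qed.

(** In each coordinate a difference of squares is the difference of the moduli times their sum. The
    constant is explicit because the rescaling has to bound the change of [q - esq z]
    quantitatively. *)
Lemma esq_lipschitz z w : rnorm (w - z) <= 1 ->
  `|esq w - esq z| <= n%:R * (2 * rnorm z + 1) * rnorm (w - z).
Proof.
move=> wz1; rewrite /esq -sumrB; apply: (le_trans (ler_norm_sum _ _ _)).
have -> : n%:R * (2 * rnorm z + 1) * rnorm (w - z) =
    \sum_(i < n) (2 * rnorm z + 1) * rnorm (w - z).
  by rewrite sumr_const card_ord -mulrA mulr_natl.
apply: ler_sum => i _.
have zi := coord_le_rnorm z i.
have di : normc (w ord0 i - z ord0 i) <= rnorm (w - z).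
  by have := coord_le_rnorm (w - z) i; rewrite !mxE.
have zi0 := normc_ge0 (z ord0 i); have wi0 := normc_ge0 (w ord0 i).
have h1 : normc (w ord0 i) <= normc (z ord0 i) + normc (w ord0 i - z ord0 i).
  by rewrite -{1}(subrK (z ord0 i) (w ord0 i)) addrC normcD.
have h2 : normc (z ord0 i) <= normc (w ord0 i) + normc (w ord0 i - z ord0 i).
  by rewrite -{1}(subKr (w ord0 i) (z ord0 i)) normcB.
rewrite subr_sqr mulrC normrM; apply: ler_pM => //.
  by rewrite ger0_norm ?addr_ge0//; lra.
by rewrite ler_norml; apply/andP; split; lra.
Qed.

Lemma esq_continuous : continuous (esq : Cn -> R).
Proof.
move=> z; apply/(@cvgrPdist_le _ R^o _ (nbhs z)) => e e0; apply/rnorm_nbhsP.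
pose L := n%:R * (2 * rnorm z + 1) + 1.
have L0 : 0 < L.
  by rewrite ltr_wpDl// mulr_ge0// addr_ge0// mulr_ge0// rnorm_ge0.
exists (Num.min 1 (e / L)); first by rewrite lt_min ltr01 divr_gt0.
move=> w; rewrite lt_min => /andP[w1 we]; rewrite distrC.
apply: (le_trans (esq_lipschitz (ltW w1))).
apply: (@le_trans _ _ (L * rnorm (w - z))).
  by rewrite ler_wpM2r ?rnorm_ge0// lerDl.
by rewrite mulrC -ler_pdivlMr// ltW.
Qed.

Lemma esq_near z (c : R) : esq z < c -> exists2 d : R, 0 < d &
  forall w, rnorm (w - z) < d -> esq w < c.
Proof.
move=> zc; have /(@cvgrPdist_lt _ R^o _ (nbhs z)) := esq_continuous (x := z).
move=> /(_ (c - esq z)); rewrite subr_gt0 => /(_ zc) /rnorm_nbhsP[d d0 H].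
by exists d => // w /H; rewrite ltr_norml => /andP[]; lra.
Qed.

Definition box (s : R) : set Cn := [set z | forall i, csquare 0 s (z ord0 i)].

Lemma box_compact s : compact (box s).
Proof.
exact: (@rV_compact C n (fun=> csquare 0 s) (fun=> @csquare_compact R 0 s)).
Qed.

Lemma box_ge z s : rnorm z <= s -> box s z.
Proof.
move=> zs i; have zi := le_trans (coord_le_rnorm z i) zs.
have := le_trans (Re_le_normc _) zi; have := le_trans (Im_le_normc _) zi.
rewrite !ler_norml => /andP[? ?] /andP[? ?].
by rewrite /csquare /crect /= !add0r; split; apply/andP.
Qed.

Definition closed_ball_sq (c : R) : set Cn := [set z | esq z <= c].

Lemma closed_ball_sq_compact c : c <= 1 -> compact (closed_ball_sq c).
Proof.
move=> c1.
have -> : closed_ball_sq c = closed_ball_sq c `&` box 1.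
  by apply/seteqP; split=> [z zc|z []//]; split=> //; apply/box_ge/rnorm_esq_le; exact: le_trans c1.
rewrite setIC; apply: compact_closedI; first exact: box_compact.
have -> : closed_ball_sq c = esq @^-1` [set x | x <= c] by [].
apply: closed_comp; last exact: closed_le.
by move=> z _; exact: esq_continuous.
Qed.

Lemma esqZ (t : R) z : esq (ofR t *: z) = t ^+ 2 * esq z.
Proof.
rewrite /esq mulr_sumr; apply: eq_bigr => i _.
by rewrite mxE normcM normc_ofR exprMn real_normK ?num_real.
Qed.

Theorem marty (F : set (Cn -> C)) :
  (forall f, F f -> holomorphic_on (unit_ball R n) f) ->
  (forall r : R, r < 1 -> exists2 M : R, 0 < M & forall f, F f -> forall z,
    esq z <= r -> forall v,
    normc ('d f z v) <= M * rnorm v * (1 + normc (f z) ^+ 2)) ->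
  normal_on (unit_ball R n) F.
Proof.
move=> F_hol F_bound f_ Ff.
have [U [UU Uoo]] := ultraFilterLemma (eventually_filter : ProperFilter \oo).
have U_open z : unit_ball R n z -> exists2 r : R, 0 < r &
    forall w, rnorm (w - z) < r -> unit_ball R n w.
  by move=> /unit_ballE/esq_near[d d0 Hd]; exists d => // w /Hd/unit_ballE.
have U_star z (t : R) : unit_ball R n z -> 0 <= t <= 1 ->
    unit_ball R n (ofR t *: z).
  move=> /unit_ballE z1 /andP[t0 t1]; apply/unit_ballE; rewrite esqZ.
  apply: le_lt_trans z1; rewrite ler_piMl ?esq_ge0//.
  by rewrite expr_le1.
have bound z : unit_ball R n z -> exists r M : R,
    [/\ 0 < r, 0 < M & U [set j | forall w, rnorm (w - z) < r ->
    differentiable (f_ j) w /\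
    forall v, normc ('d (f_ j) w v) <= M * rnorm v * (1 + normc (f_ j w) ^+ 2)]].
  move=> /unit_ballE z1.
  have zc : esq z < (esq z + 1) / 2 by lra.
  have c1 : (esq z + 1) / 2 < 1 by lra.
  have [r r0 Hr] := esq_near zc; have [M M0 HM] := F_bound _ c1.
  exists r, M; split => //; apply: filterE => j w /Hr wc; split.
    by apply: (F_hol _ (Ff j)); apply/unit_ballE; exact: lt_trans c1.
  by move=> v; apply: HM => //; exact: ltW.
pose K_ m := closed_ball_sq (1 - m.+1%:R^-1).
have K_compact m : compact (K_ m).
  by apply: closed_ball_sq_compact; rewrite gerBl invr_ge0.
have K_sub m : K_ m `<=` unit_ball R n.
  move=> z /= zm; apply/unit_ballE; apply: (le_lt_trans zm).
  by rewrite gtrBl invr_gt0.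
have K_exhaust z : unit_ball R n z -> exists2 d : R, 0 < d &
    \forall m \near \oo, forall w, rnorm (w - z) < d -> K_ m w.
  move=> /unit_ballE z1.
  have zc : esq z < (esq z + 1) / 2 by lra.
  have c1 : 0 < 1 - (esq z + 1) / 2 by lra.
  have [d d0 Hd] := esq_near zc; exists d => //.
  near=> m => w /Hd wc; apply: (le_trans (ltW wc)).
  rewrite lerBrDr addrC -lerBrDr; apply: ltW.
  by near: m; exact: near_infty_natSinv_lt (PosNum c1).
have [[u [ud Hu]]|Hinf] := marty_ultra U_open U_star bound.
  (* Accuracy [1 / (m + 1)] on the [m]-th ball of the exhaustion is asked of the [m]-th term, so
     that a single subsequence serves all compact sets. *)
  pose P m j := forall z, K_ m z -> normc (f_ j z - u z) <= m.+1%:R^-1.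
  have [m|phi [phi_inc HP]] := @extract_subsequence U P _ Uoo.
    apply: compact_uniform => // z /K_sub Uz.
    by apply: Hu => //; rewrite invr_gt0.
  exists phi; split=> //; left; exists u; split=> [z /ud //|K cK KU].
  split; first by apply: filterE.
  exact: (cvg_loc_unif_exhaustion K_exhaust HP cK KU).
pose P m j := forall z, K_ m z -> m%:R < normc (f_ j z).
have [m|phi [phi_inc HP]] := @extract_subsequence U P _ Uoo.
  by apply: compact_uniform => // z /K_sub Uz; exact: Hinf.
exists phi; split=> //; right=> K cK KU M.
have KK := compact_in_exhaustion K_exhaust cK KU.
have mM : \forall m \near \oo, M <= m%:R.
  by near=> m; near: m; exact: nbhs_infty_ger.
by apply: filterS2 KK mM => m Km mM' z /Km /HP; exact: le_lt_trans.
Unshelve. all: by end_near. Qed.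

End RowVectors.

(** * Rescaling *)

Section AffineRescaling.
Context {R : realType}.
Local Notation C := (Cplx R).
Variable V : normedModType C.

Lemma diff_scale (f : V -> C) (x v : V) (k : C) : 'd f x (k *: v) = k * 'd f x v.
Proof. by rewrite linearZ. Qed.

Definition rescale (alpha : R) (f : V -> C) (z : V) (rho : R) (zeta : V) : C :=
  f (z + ofR rho *: zeta) / ofR (rho `^ alpha).

Lemma rescale_diff (alpha : R) (f : V -> C) (z : V) (rho : R) (zeta : V) :
  differentiable f (z + ofR rho *: zeta) ->
  differentiable (rescale alpha f z rho) zeta /\
  forall v, 'd (rescale alpha f z rho) zeta v =
    ofR (rho / rho `^ alpha) * 'd f (z + ofR rho *: zeta) v.
Proof.
move=> fd.
pose h (x : V) : V := z + ofR rho *: x.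
have hd : is_diff zeta h (fun v => ofR rho *: v).
  have := is_diffD (is_diff_cst z zeta) (is_diffZ (ofR rho) (is_diff_id zeta)).
  by move=> /is_diff_eq; apply; apply/funext => v; rewrite !fctE add0r.
have fhd := is_diff_comp hd (differentiableP fd).
have gd := is_diffZ (ofR (rho `^ alpha))^-1 fhd.
have rE : rescale alpha f z rho = (ofR (rho `^ alpha))^-1 *: (f \o h).
  by apply/funext => x; rewrite /rescale mulrC.
have [gd1 gd2] := gd.
rewrite -rE in gd1 gd2; split=> [|v]; first exact: gd1.
have E : 'd (rescale alpha f z rho) zeta v =
    (ofR (rho `^ alpha))^-1 * 'd f (h zeta) (ofR rho *: v).
  exact: (congr1 (fun G : V -> C => G v) gd2).
rewrite E diff_scale ofRM ofRV mulrA.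
by rewrite [_^-1 * _]mulrC.
Qed.

End AffineRescaling.

Section Rescaling.
Context {R : realType} {n : nat}.
Local Notation C := (Cplx R).
Local Notation Cn := 'rV[C]_n.
Variable alpha : R.
Hypotheses (a0 : 0 <= alpha) (a1 : alpha < 1).

(* The rescaling of [f] at [z] with scale [rho] has, at the origin and in the
   direction [v], a spherical derivative at least [1]. *)
Definition steep (q : R) (f : Cn -> C) (z v : Cn) (rho : R) :=
  [/\ esq z < q, rnorm v <= 1, 0 < rho &
      (rho `^ alpha) ^+ 2 + normc (f z) ^+ 2 <=
        rho * rho `^ alpha * normc ('d f z v)].

(** A continuous [f] is bounded near each point, so Cauchy's estimate on balls of a fixed radius
    around neighbouring points bounds the derivative there. The bound is the filter index [m], which
    lets [compact_uniform] yield a common one. *)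
Lemma derivative_bounded (f : Cn -> C) (q : R) : q < 1 ->
  holomorphic_on (unit_ball R n) f ->
  exists2 B : R, 0 < B &
    forall z v, esq z <= q -> rnorm v <= 1 -> normc ('d f z v) <= B.
Proof.
move=> q1 f_hol.
have H : \forall m \near \oo, forall z : Cn, closed_ball_sq q z ->
    forall v, normc ('d f z v) <= m%:R * rnorm v.
  apply: (@compact_uniform _ _ \oo _ _
    (fun m z => forall v, normc ('d f z v) <= m%:R * rnorm v)).
    by apply: closed_ball_sq_compact; exact: ltW.
  move=> x xq; have x1 : esq x < 1 := le_lt_trans xq q1.
  have [d d0 Hd] := esq_near x1.
  have fx : differentiable f x by apply: f_hol; apply/unit_ballE.
  have /cvgrPdist_lt/(_ (ofR 1)) := differentiable_continuous fx.
  rewrite -ofR0 ofR_lt => /(_ ltr01) /rnorm_nbhsP[e e0 He].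
  pose K := normc (f x) + 1.
  pose r := Num.min (d / 2) (e / 2).
  have r0 : 0 < r by rewrite lt_min !divr_gt0.
  exists r => //.
  have [rd re] : r <= d / 2 /\ r <= e / 2 by rewrite !ge_min !lexx orbT.
  near=> m => z zr v.
  have in2 w : rnorm (w - z) < r -> rnorm (w - x) < d /\ rnorm (w - x) < e.
    move=> wz; have -> : w - x = (w - z) + (z - x) by rewrite addrA subrK.
    by have := rnormD (w - z) (z - x); split; lra.
  apply: (le_trans (@cauchy_estimate _ _ f z r K r0 _ _ v)).
  - by move=> w /in2[/Hd wd _]; apply: f_hol; apply/unit_ballE.
  - move=> w /in2[_ /He]; rewrite absCE ofR_lt normc_distC => h.
    rewrite -{1}(subrK (f x) (f w)) /K addrC; apply: (le_trans (normcD _ _)).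
    by rewrite lerD2l ltW.
  - by rewrite ler_wpM2r ?rnorm_ge0//; near: m; exact: nbhs_infty_ger.
have [m Hm] := filter_ex H.
exists (m%:R + 1); first by rewrite ltr_wpDl.
move=> z v zq v1; apply: (le_trans (Hm z zq v)).
apply: (@le_trans _ _ (m%:R * 1)); first by rewrite ler_wpM2l.
by rewrite mulr1 lerDl.
Unshelve. all: by end_near. Qed.

(** Dropping [normc (f z) ^+ 2] from [steep] and dividing by the square of [rho]^ alpha[leaves]1 <=
    rho [^ (1 - alpha) * B]. As [alpha < 1], this keeps [rho] away from 0. *)
Lemma steep_scale_bounded (f : Cn -> C) (q : R) : q < 1 ->
  holomorphic_on (unit_ball R n) f ->
  exists2 m : R, 0 < m & forall z v rho, steep q f z v rho -> m <= rho.
Proof.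
move=> q1 /(derivative_bounded q1)[B B0 HB].
exists (B^-1 `^ (1 - alpha)^-1); first by apply: powR_gt0; rewrite invr_gt0.
move=> z v rho [zq v1 rho0 H].
have P0 : 0 < rho `^ alpha by rewrite powR_gt0.
have : (rho `^ alpha) ^+ 2 <= rho * rho `^ alpha * B.
  apply: (@le_trans _ _ ((rho `^ alpha) ^+ 2 + normc (f z) ^+ 2)).
    by rewrite lerDl sqr_ge0.
  apply: (le_trans H); rewrite ler_wpM2l ?mulr_ge0 ?(ltW rho0) ?(ltW P0)//.
  by apply: HB => //; exact: ltW.
have rhoE : rho = rho `^ alpha * rho `^ (1 - alpha).
  rewrite -powRD; last by rewrite (gt_eqF rho0) implybT.
  have -> : alpha + (1 - alpha) = 1 by ring.
  by rewrite powRr1// ltW.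
rewrite expr2 mulrAC ler_pM2r// {2}rhoE -mulrA.
rewrite -[X in X <= _]mulr1 ler_pM2l// => HB1.
have b1 : 0 < 1 - alpha by rewrite subr_gt0.
have : B^-1 <= rho `^ (1 - alpha) by rewrite -[leLHS]mul1r ler_pdivrMr.
move=> /(ge0_ler_powR (r := (1 - alpha)^-1)).
rewrite !nnegrE invr_ge0 (ltW b1) invr_ge0 (ltW B0) powR_ge0 => /(_ isT isT isT).
by rewrite -powRrM mulfV ?gt_eqF// powRr1// ltW.
Qed.

(* Comparisons of the ratios [rho / (q - esq z)] are stated with the denominators
   cleared. *)
Lemma almost_minimal (f : Cn -> C) (q t : R) (z : Cn) (v : Cn) (rho : R) :
  q < 1 -> holomorphic_on (unit_ball R n) f ->
  steep q f z v rho -> rho <= t * (q - esq z) ->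
  exists z' v' rho', [/\ steep q f z' v' rho', rho' <= 2 * t * (q - esq z') &
    forall w u s, 2 * s * (q - esq z') < rho' * (q - esq w) ->
      ~ steep q f w u s].
Proof.
move=> q1 f_hol st rt.
have [m m0 Hm] := steep_scale_bounded q1 f_hol.
pose S := [set x | exists z' v' rho', steep q f z' v' rho' /\
  x = rho' / (q - esq z')].
have Sge x : S x -> m <= x.
  move=> [z' [v' [rho' [st' ->]]]]; have [zq _ rho0 _] := st'.
  have d0 : 0 < q - esq z' by rewrite subr_gt0.
  rewrite ler_pdivlMr// (le_trans _ (Hm _ _ _ st'))// ler_piMr// ?(ltW m0)//.
  by have := esq_ge0 z'; lra.
have S0 : S !=set0 by exists (rho / (q - esq z)), z, v, rho.
have infS : has_inf S by split => //; exists m => x; exact: Sge.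
have T0 : 0 < inf S by apply: lt_le_trans m0 _; apply: lb_le_inf => // x; exact: Sge.
have Tt : inf S <= t.
  have [zq _ _ _] := st; have d0 : 0 < q - esq z by rewrite subr_gt0.
  apply: (@le_trans _ _ (rho / (q - esq z))); last by rewrite ler_pdivrMr.
  by apply: ge_inf; [case: infS | exists z, v, rho].
(* The slack allowed is the infimum itself, which is positive: the chosen ratio is less than twice
   the infimum. *)
have [x [z' [v' [rho' [st' xE]]]] x2] := inf_adherent T0 infS.
have [zq' _ rho0' _] := st'; have d0' : 0 < q - esq z' by rewrite subr_gt0.
exists z', v', rho'; split=> //.
  rewrite -ler_pdivrMr// -xE; lra.
move=> w u s lt_s stw; have [wq _ s0 _] := stw.
have dw : 0 < q - esq w by rewrite subr_gt0.
have : inf S <= s / (q - esq w) by apply: ge_inf; [case: infS | exists w, u, s].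
apply/negP; rewrite -ltNge ltr_pdivrMr// -(ltr_pM2l (x := 2))//.
apply: (@lt_le_trans _ _ (rho' / (q - esq z') * (q - esq w))).
  by rewrite mulrAC ltr_pdivlMr.
by rewrite mulrA ler_pM2r// -xE; lra.
Qed.

End Rescaling.

(** * Spherical derivatives of the rescaled functions *)

Section RescaledBounds.
Context {R : realType} {n : nat}.
Local Notation C := (Cplx R).
Local Notation Cn := 'rV[C]_n.
Variable alpha : R.
Hypotheses (a0 : 0 <= alpha) (a1 : alpha < 1).

Lemma powR_quarter (rho : R) : 0 < rho ->
  (rho / 4) `^ alpha <= rho `^ alpha /\ rho `^ alpha <= 4 * (rho / 4) `^ alpha.
Proof.
move=> rho0; have r4 : 0 <= rho / 4 by rewrite divr_ge0// ltW.
split; first by apply: ge0_ler_powR; rewrite ?nnegrE ?(ltW rho0)//; lra.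
have -> : rho `^ alpha = 4 `^ alpha * (rho / 4) `^ alpha.
  by rewrite -powRM//; congr (_ `^ _); field.
rewrite ler_wpM2r ?powR_ge0//.
by rewrite -[leRHS]powRr1// ler_powR ?ler1n// ltW.
Qed.

Lemma rescale_spherical_bound (f : Cn -> C) (q tau S rho : R) (z zeta : Cn) :
  q < 1 -> holomorphic_on (unit_ball R n) f ->
  esq z < q -> 0 < rho -> rho <= tau * (q - esq z) ->
  rnorm zeta <= S -> tau * S <= 1 -> 6 * n%:R * (tau * S) < 1 ->
  (forall w u s, 2 * s * (q - esq z) < rho * (q - esq w) ->
      ~ steep alpha q f w u s) ->
  [/\ esq (z + ofR rho *: zeta) < 1,
      differentiable (rescale alpha f z rho) zeta &
      forall v, normc ('d (rescale alpha f z rho) zeta v) <=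
        16 * rnorm v * (1 + normc (rescale alpha f z rho zeta) ^+ 2)].
Proof.
move=> q1 f_hol zq rho0 rho_le zetaS tS1 tS6 maxi.
set dz := q - esq z in rho_le maxi.
have dz0 : 0 < dz by rewrite subr_gt0.
have dz1 : dz <= 1 by rewrite /dz; have := esq_ge0 z; lra.
set w := z + ofR rho *: zeta.
have wz : rnorm (w - z) <= dz * (tau * S).
  rewrite /w addrAC subrr add0r rnormZ normc_ofR gtr0_norm// mulrA [dz * _]mulrC.
  by apply: ler_pM => //; [exact: ltW|exact: rnorm_ge0].
have tS0 : 0 <= tau * S.
  by rewrite -(pmulr_rge0 _ dz0); exact: le_trans (rnorm_ge0 _) wz.
have wz1 : rnorm (w - z) <= 1.
  apply: (le_trans wz); rewrite -[leRHS]mulr1; apply: ler_pM => //; exact: ltW.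
have z1 : rnorm z <= 1 by apply: rnorm_esq_le; exact: ltW (lt_trans zq q1).
(* As [rnorm z <= 1], the Lipschitz constant of [esq] is at most [3 * n%:R]; asking for a change
   below [dz / 2] doubles it to the 6 in the hypothesis. *)
have ewz : `|esq w - esq z| < dz / 2.
  apply: le_lt_trans (esq_lipschitz wz1) _.
  apply: (@le_lt_trans _ _ (n%:R * 3 * (dz * (tau * S)))).
    apply: ler_pM; rewrite ?rnorm_ge0// ?mulr_ge0 ?addr_ge0 ?mulr_ge0 ?rnorm_ge0//.
    by rewrite ler_wpM2l//; lra.
  have -> : n%:R * 3 * (dz * (tau * S)) = dz / 2 * (6 * n%:R * (tau * S)) by field.
  by rewrite gtr_pMr// divr_gt0.
have dw : dz / 2 < q - esq w.
  by move: ewz; rewrite ltr_norml /dz => /andP[? ?]; lra.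
have wq : esq w < q by rewrite -subr_gt0; apply: le_lt_trans dw; rewrite divr_ge0// ltW.
have w1 : esq w < 1 := lt_trans wq q1.
have fw : differentiable f w by apply: f_hol; apply/unit_ballE.
have [gd gE] := rescale_diff alpha fw.
split=> // v; rewrite gE -/w.
have [->|v0] := eqVneq v 0.
  by rewrite linear0 mulr0 normc0 rnorm0 mulr0 mul0r.
have nv : 0 < rnorm v by rewrite lt_neqAle eq_sym rnorm_eq0 v0 rnorm_ge0.
pose v' := ofR (rnorm v)^-1 *: v.
have vE : v = ofR (rnorm v) *: v'.
  by rewrite scalerA -ofRM mulfV ?gt_eqF// ofR1 scale1r.
have v'1 : rnorm v' <= 1.
  by rewrite rnormZ normc_ofR gtr0_norm ?invr_gt0// mulVf// gt_eqF.
have r4 : 0 < rho / 4 by rewrite divr_gt0.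
have [P1 P2] := powR_quarter rho0.
have P0 : 0 < rho `^ alpha by apply: powR_gt0.
set P := rho `^ alpha in P0 P1 P2 *; set P' := (rho / 4) `^ alpha in P1 P2.
have P'0 : 0 <= P' by exact: powR_ge0.
have nst : ~ steep alpha q f w v' (rho / 4).
  apply: maxi; have -> : 2 * (rho / 4) * dz = rho * (dz / 2) by field.
  by rewrite ltr_pM2l.
set D := normc ('d f w v').
have HD : rho / 4 * P' * D < P' ^+ 2 + normc (f w) ^+ 2.
  by rewrite ltNge; apply/negP => H; apply: nst; split.
have main : rho * P * D <= 16 * (P ^+ 2 + normc (f w) ^+ 2).
  have D0 : 0 <= D := normc_ge0 _.
  apply: (@le_trans _ _ (16 * (rho / 4 * P' * D))).
    have -> : 16 * (rho / 4 * P' * D) = rho * (4 * P') * D by field.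
    by rewrite ler_wpM2r// ler_wpM2l// ltW.
  rewrite ler_pM2l//; apply: (le_trans (ltW HD)); rewrite lerD2r.
  by rewrite lerXn2r ?nnegrE// ltW.
have gn : normc (rescale alpha f z rho zeta) ^+ 2 = normc (f w) ^+ 2 / P ^+ 2.
  rewrite /rescale -/w normcM normcV normc_ofR gtr0_norm ?powR_gt0//.
  by rewrite exprMn exprVn.
rewrite gn {1}vE diff_scale !normcM !normc_ofR -/D.
rewrite (gtr0_norm (divr_gt0 rho0 P0)) (gtr0_norm nv).
have -> : rho / P * (rnorm v * D) = (rho * P * D) * (rnorm v / P ^+ 2).
  by field; rewrite gt_eqF.
have -> : 16 * rnorm v * (1 + normc (f w) ^+ 2 / P ^+ 2) =
    16 * (P ^+ 2 + normc (f w) ^+ 2) * (rnorm v / P ^+ 2).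
  by field; rewrite gt_eqF.
by rewrite ler_wpM2r// divr_ge0 ?exprn_ge0 ?(ltW nv) ?(ltW P0).
Qed.

Lemma rescale_steep (f : Cn -> C) (q rho : R) (z v : Cn) :
  q < 1 -> holomorphic_on (unit_ball R n) f -> steep alpha q f z v rho ->
  1 + normc (rescale alpha f z rho 0) ^+ 2 <=
    normc ('d (rescale alpha f z rho) 0 v).
Proof.
move=> q1 f_hol [zq v1 rho0 H].
have z0 : z + ofR rho *: (0 : Cn) = z by rewrite scaler0 addr0.
have fz : differentiable f (z + ofR rho *: (0 : Cn)).
  by rewrite z0; apply: f_hol; apply/unit_ballE; exact: lt_trans q1.
have [_ gE] := rescale_diff alpha fz.
have P0 : 0 < rho `^ alpha by apply: powR_gt0.
rewrite gE /rescale z0 !normcM normcV !normc_ofR.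
rewrite (gtr0_norm P0) (gtr0_norm (divr_gt0 rho0 P0)) exprMn exprVn.
set P := rho `^ alpha in P0 H *.
have -> : 1 + normc (f z) ^+ 2 * (P ^+ 2)^-1 =
    (P ^+ 2 + normc (f z) ^+ 2) * (P ^+ 2)^-1 by field; rewrite gt_eqF.
have -> : rho / P * normc ('d f z v) = (rho * P * normc ('d f z v)) * (P ^+ 2)^-1.
  by field; rewrite gt_eqF.
by rewrite ler_wpM2r// invr_ge0 exprn_ge0// ltW.
Qed.

(** Marty's criterion fails on some ball [esq z <= r] with [r < 1]. Taking [q] halfway between [r]
    and 1 keeps [q - esq z] at least [q - r] there, so that the scale [t * (q - esq z)] does not
    degenerate. *)
Lemma steep_start (F : set (Cn -> C)) :
  (forall f, F f -> holomorphic_on (unit_ball R n) f) ->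
  ~ normal_on (unit_ball R n) F ->
  exists q : R, [/\ 0 < q, q < 1 & forall t : R, 0 < t -> t <= 1 ->
    exists f z v, F f /\ steep alpha q f z v (t * (q - esq z))].
Proof.
move=> F_hol nF.
have [r [r1 Hr]] : exists r : R, r < 1 /\ forall M : R, 0 < M ->
    exists f z v, [/\ F f, esq z <= r &
      M * rnorm v * (1 + normc (f z) ^+ 2) < normc ('d f z v)].
  apply: contrapT => H; apply: nF; apply: marty => // r r1.
  apply: contrapT => HM; apply: H; exists r; split => // M M0.
  apply: contrapT => Hf; apply: HM; exists M => // f Ff z zr v.
  rewrite leNgt; apply/negP => lt_v; apply: Hf.
  by exists f, z, v.
have r0 : 0 <= r.
  have [f [z [v [_ zr _]]]] := Hr 1 ltr01.
  exact: le_trans (esq_ge0 z) zr.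
exists ((r + 1) / 2); split; [lra|lra|move=> t t0 t1].
set q := (r + 1) / 2; have qr : 0 < q - r by rewrite /q; lra.
have q1 : q < 1 by rewrite /q; lra.
pose s := t * (q - r); have s0 : 0 < s by rewrite mulr_gt0.
have sP : 0 < s `^ alpha by apply: powR_gt0.
have [|f [z [v [Ff zr Hv]]]] := Hr (s * s `^ alpha)^-1.
  by rewrite invr_gt0 mulr_gt0.
have v0 : v != 0.
  by apply/eqP => v0; move: Hv; rewrite v0 linear0 normc0 rnorm0 mulr0 mul0r ltxx.
have nv : 0 < rnorm v by rewrite lt_neqAle eq_sym rnorm_eq0 v0 rnorm_ge0.
pose v' := ofR (rnorm v)^-1 *: v.
have vE : v = ofR (rnorm v) *: v'.
  by rewrite scalerA -ofRM mulfV ?gt_eqF// ofR1 scale1r.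
have v'1 : rnorm v' <= 1.
  by rewrite rnormZ normc_ofR gtr0_norm ?invr_gt0// mulVf// gt_eqF.
have Hv' : 1 + normc (f z) ^+ 2 < s * s `^ alpha * normc ('d f z v').
  rewrite -ltr_pdivrMl ?mulr_gt0//.
  move: Hv; rewrite {2}vE diff_scale normcM normc_ofR gtr0_norm//.
  by rewrite [_^-1 * rnorm v]mulrC -mulrA ltr_pM2l.
have zq : esq z < q by apply: le_lt_trans zr _; rewrite -subr_gt0.
set rho := t * (q - esq z).
have rho0 : 0 < rho by rewrite mulr_gt0// subr_gt0.
have srho : s <= rho by rewrite ler_pM2l// lerD2l lerN2.
have rho1 : rho <= 1.
  rewrite -[leRHS]mulr1; apply: ler_pM => //; rewrite ?(ltW t0) ?subr_ge0 ?(ltW zq)//.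
  by have := esq_ge0 z; lra.
have P1 : rho `^ alpha <= 1.
  have -> : 1 = 1 `^ alpha :> R by rewrite powR1.
  by apply: ge0_ler_powR; rewrite ?nnegrE ?(ltW rho0).
exists f, z, v'; split=> //; split=> //.
apply: (@le_trans _ _ (1 + normc (f z) ^+ 2)).
  by rewrite lerD2r expr_le1// powR_ge0.
apply: (le_trans (ltW Hv')); rewrite ler_wpM2r ?normc_ge0//.
apply: ler_pM => //; rewrite ?(ltW s0) ?(ltW sP)//.
by apply: ge0_ler_powR; rewrite ?nnegrE ?(ltW rho0) ?(ltW s0).
Qed.

End RescaledBounds.

(** * The theorem of Zalcman and Pang *)

Section SphericalDerivative.
Context {R : realType}.
Local Notation C := (Cplx R).
Variables (V : normedModType C) (f : V -> C) (v : V).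
Hypothesis fd : forall z, rnorm (z - 0) < 1 -> differentiable f z.
Hypothesis v1 : rnorm v <= 1.

Let zero_in : rnorm ((0 : V) - 0) < 1. Proof. by rewrite subr0 rnorm0. Qed.

(** A function and its reciprocal have the same spherical derivative. The reciprocal is at most 1/96
    on the unit ball, so Cauchy's estimate bounds its derivative by 48/96. *)
Lemma large_spherical_derivative : (forall z, rnorm (z - 0) < 1 -> 96 < normc (f z)) ->
  normc ('d f 0 v) < 1 + normc (f 0) ^+ 2.
Proof.
move=> f96; have f0 := f96 0 zero_in.
have nz z : rnorm (z - 0) < 1 -> f z != 0.
  by move=> /f96 h; rewrite -normc_gt0; lra.
have hd z : rnorm (z - 0) < 1 -> differentiable (fun x => (f x)^-1) z.
  by move=> z1; apply: differentiableV; [exact: fd|exact: nz].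
have hM z : rnorm (z - 0) < 1 -> normc (f z)^-1 <= 96^-1.
  move=> /f96 h; rewrite normcV lef_pV2 ?posrE//; first exact: ltW.
  by apply: lt_trans h.
have E : 'd (fun x => (f x)^-1) 0 v = - (f 0) ^- 2 * 'd f 0 v.
  exact: (congr1 (fun G : V -> C => G v) (diffV (fd zero_in) (nz 0 zero_in))).
have H := cauchy_estimate ltr01 hd hM v.
have {H} : normc (- (f 0) ^- 2 * 'd f 0 v) <= 48 * 96^-1 / 1 * rnorm v.
  by apply: le_trans H; rewrite le_eqVlt -E eqxx.
rewrite normcM normc_oppr normcV normcX => H.
have n2 : 0 < normc (f 0) ^+ 2 by rewrite exprn_gt0// normc_gt0 nz.
have : (normc (f 0) ^+ 2)^-1 * normc ('d f 0 v) <= 1.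
  apply: (le_trans H); rewrite divr1; apply: (@le_trans _ _ (48 * 96^-1 * 1)).
    by rewrite ler_wpM2l.
  by rewrite mulr1; lra.
by rewrite ler_pdivrMl// mulr1 => /le_lt_trans; apply; rewrite ltrDr.
Qed.

(** Cauchy's estimate for [f - c], again with 48/96. Together with the preceding lemma it excludes
    infinite and constant limits without any convergence of derivatives. *)
Lemma almost_constant_derivative (c : C) :
  (forall z, rnorm (z - 0) < 1 -> normc (f z - c) <= 96^-1) ->
  normc ('d f 0 v) < 1.
Proof.
move=> fc.
have hd z : rnorm (z - 0) < 1 -> differentiable (f - cst c) z.
  by move=> /fd z1; apply: differentiableB.
have E : 'd (f - cst c) 0 v = 'd f 0 v.
  have E := diffB (fd zero_in) (differentiable_cst c (0 : V)).
  have Z : 'd (cst c) (0 : V) v = 0 :> C.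
    exact: (congr1 (fun G : V -> C => G v) (diff_cst c (0 : V))).
  transitivity ('d f 0 v - 'd (cst c) (0 : V) v).
    exact: (congr1 (fun G : V -> C => G v) E).
  by apply: (etrans (congr1 (fun y => 'd f 0 v - y) Z)); exact: subr0.
have H := cauchy_estimate ltr01 hd fc v.
have : normc ('d f 0 v) <= 48 * 96^-1 / 1 * rnorm v.
  apply: le_trans H; rewrite le_eqVlt; apply/orP; left; apply/eqP.
  exact: (congr1 (@normc R) (esym E)).
move=> /le_lt_trans; apply; rewrite divr1.
apply: (@le_lt_trans _ _ (48 * 96^-1 * 1)); first by rewrite ler_wpM2l.
by rewrite mulr1; lra.
Qed.

End SphericalDerivative.

Theorem theorem2p1 (R : realType) (n : nat) (n_ge1 : (1 <= n)%N)
    (F : set ('rV[Cplx R]_n -> Cplx R))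
    (F_hol : forall f, F f -> holomorphic_on (unit_ball R n) f)
    (F_not_normal : ~ normal_on (unit_ball R n) F) :
  forall alpha : R, 0 <= alpha -> alpha < 1 ->
  exists (r : R) (z_ : nat -> 'rV[Cplx R]_n)
         (f_ : nat -> 'rV[Cplx R]_n -> Cplx R) (rho_ : nat -> R)
         (g : 'rV[Cplx R]_n -> Cplx R),
    (0 < r /\ r < 1) /\
    (forall j, unit_ball R n (z_ j) /\ enorm (z_ j) < r) /\
    (forall j, F (f_ j)) /\
    (forall j, 0 < rho_ j /\ rho_ j <= 1) /\
    rho_ @ \oo --> (0 : R) /\
    entire g /\
    nonconstant g /\
    cvg_loc_unif setT
      (fun j => [set zeta | unit_ball R n (z_ j + ofR (rho_ j) *: zeta)])
      (fun j zeta => f_ j (z_ j + ofR (rho_ j) *: zeta) / ofR (rho_ j `^ alpha))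
      g.
Proof.
move=> alpha a0 a1.
have [q [q0 q1 start]] := steep_start a0 F_hol F_not_normal.
pose good k (d : ('rV[Cplx R]_n -> Cplx R) * 'rV[Cplx R]_n * 'rV[Cplx R]_n * R) :=
  [/\ F d.1.1.1, steep alpha q d.1.1.1 d.1.1.2 d.1.2 d.2,
      d.2 <= k.+1%:R^-1 * (q - esq d.1.1.2) &
      forall w u s, 2 * s * (q - esq d.1.1.2) < d.2 * (q - esq w) ->
        ~ steep alpha q d.1.1.1 w u s].
have [D HD] : exists D, forall k, good k (D k).
  suff /choice[D HD] : forall k, exists d, good k d by exists D.
  (* The near-minimal pair may have twice the initial ratio, so half of [1 / (k + 1)] is
     prescribed. *)
  move=> k; pose t : R := (2 * k.+1%:R)^-1.
  have t0 : 0 < t by rewrite invr_gt0 mulr_gt0.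
  have t1 : t <= 1 by rewrite invf_le1 ?mulr_gt0// -natrM ler1n.
  have [f [z [v [Ff st]]]] := start t t0 t1.
  have [z' [v' [rho' [st' rho_le maxi]]]] :=
    almost_minimal a1 q1 (F_hol f Ff) st (lexx _).
  exists (f, z', v', rho'); split => //=.
  by move: rho_le; rewrite /t invfM mulrA mulfV// mul1r.
pose f_ k := (D k).1.1.1; pose z_ k := (D k).1.1.2.
pose v_ k := (D k).1.2; pose rho_ k := (D k).2.
have Ff k : F (f_ k) by have [] := HD k.
have st k : steep alpha q (f_ k) (z_ k) (v_ k) (rho_ k) by have [] := HD k.
have zq k : esq (z_ k) < q by have [] := st k.
have v1 k : rnorm (v_ k) <= 1 by have [] := st k.
have rho0 k : 0 < rho_ k by have [] := st k.
have rho_le k : rho_ k <= k.+1%:R^-1 * (q - esq (z_ k)) by have [] := HD k.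
have rho_inv k : rho_ k <= k.+1%:R^-1.
  apply: (le_trans (rho_le k)); rewrite ler_piMr ?invr_ge0//.
  by have := esq_ge0 (z_ k); lra.
pose g_ k := rescale alpha (f_ k) (z_ k) (rho_ k).
have bound (S : R) : 0 <= S -> \forall k \near \oo, forall zeta, rnorm zeta <= S ->
    [/\ esq (z_ k + ofR (rho_ k) *: zeta) < 1, differentiable (g_ k) zeta &
      forall v, normc ('d (g_ k) zeta v) <=
        16 * rnorm v * (1 + normc (g_ k zeta) ^+ 2)].
  (* A common positive upper bound for [S] and [6 * n%:R * S], the two quantities that the ratio
     [1 / (k + 1)] has to compensate. *)
  move=> S0; pose c := S + 6 * n%:R * S + 1.
  have nS : 0 <= 6 * n%:R * S by rewrite mulr_ge0// mulr_ge0.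
  have c0 : 0 < c by rewrite /c; lra.
  have e0 : 0 < c^-1 by rewrite invr_gt0.
  near=> k => zeta zS.
  have kc : k.+1%:R^-1 * c < 1.
    rewrite -ltr_pdivlMr// mul1r.
    by near: k; exact: near_infty_natSinv_lt (PosNum e0).
  have k0 : 0 < k.+1%:R^-1 :> R by rewrite invr_gt0.
  have [_ _ _ maxi] := HD k.
  apply: (rescale_spherical_bound a0 a1 q1 (F_hol _ (Ff k)) (zq k) (rho0 k)
    (rho_le k) zS) => //.
  - apply: le_trans (ltW kc); rewrite ler_pM2l// /c; lra.
  - apply: le_lt_trans kc; rewrite mulrCA ler_pM2l// /c; lra.
have [G [GU Goo]] := ultraFilterLemma (eventually_filter : ProperFilter \oo).
have PG : ProperFilter G by typeclasses eauto.
have FG : Filter G by typeclasses eauto.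
have bound_G (S : R) (S0 : 0 <= S) := Goo _ (bound S S0).
have near_le x (z : 'rV[Cplx R]_n) : rnorm (z - x) < 1 -> rnorm z <= rnorm x + 1.
  by move=> zx; have := rnormD (z - x) x; rewrite subrK; lra.
have spherical x : [set: 'rV[Cplx R]_n] x -> exists r M : R,
    [/\ 0 < r, 0 < M & G [set j | forall z, rnorm (z - x) < r ->
    differentiable (g_ j) z /\
    forall v, normc ('d (g_ j) z v) <= M * rnorm v * (1 + normc (g_ j z) ^+ 2)]].
  move=> _; exists 1, 16; split => //.
  have S0 : 0 <= rnorm x + 1 by rewrite addr_ge0// rnorm_ge0.
  by apply: filterS (bound_G _ S0) => j Hj z /near_le /Hj[].
have below k : 1 + normc (g_ k 0) ^+ 2 <= normc ('d (g_ k) 0 (v_ k)) :=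
  rescale_steep q1 (F_hol _ (Ff k)) (st k).
have diff_G : G [set j | forall z, rnorm (z - 0) < 1 -> differentiable (g_ j) z].
  by apply: filterS (bound_G _ ler01) => j Hj z; rewrite subr0 => /ltW /Hj[].
have unit_box (z : 'rV[Cplx R]_n) : rnorm (z - 0) < 1 -> box 1 z.
  by rewrite subr0 => /ltW/box_ge.
have eps_gt0 (m : nat) : 0 < m.+1%:R^-1 :> R by rewrite invr_gt0.
have [[u [ud Hu]]|Hinf] := @marty_ultra _ _ G GU setT g_
    (fun x _ => ex_intro2 _ _ 1 ltr01 (fun _ _ => I)) (fun _ _ _ _ => I) spherical;
  last first.
  exfalso.
  have := @compact_uniform _ _ G FG (box 1) (fun j z => 96 < normc (g_ j z))
    (@box_compact R n 1) (fun x _ => Hinf x I 96).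
  move=> HG; have [j [/= dj jK]] := filter_ex (filterI diff_G HG).
  have := large_spherical_derivative dj (v1 j) (fun z zj => jK z (unit_box z zj)).
  by rewrite ltNge below.
pose P m j := [/\ forall z, box m%:R z -> normc (g_ j z - u z) <= m.+1%:R^-1,
  forall z, box m%:R z -> unit_ball R n (z_ j + ofR (rho_ j) *: z) &
  rho_ j <= m.+1%:R^-1].
have GP m : G [set j | P m j].
  have H1 := @compact_uniform _ _ G FG (box m%:R)
    (fun j z => normc (g_ j z - u z) <= m.+1%:R^-1) (@box_compact R n m%:R)
    (fun x _ => Hu x I _ (eps_gt0 m)).
  (* The box of half-side [m] lies in the sup-norm ball of radius [2 * m], and the bound there
     includes that the rescaled points stay in the unit ball. *)
  have S0 : 0 <= 2 * m%:R :> R by rewrite mulr_ge0.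
  have H2 := bound_G _ S0.
  have H3 : G [set j | (m <= j)%N] by apply: Goo; exists m.
  apply: filterS (filterI H1 (filterI H2 H3)) => j [/= j1 [j2 j3]]; split => //.
    move=> z zm; apply/unit_ballE.
    have zS : rnorm z <= 2 * m%:R.
      by apply: rnorm_le => // i; have := csquare_le (zm i); rewrite subr0.
    by have [] := j2 z zS.
  by apply: (le_trans (rho_inv j)); rewrite lef_pV2 ?posrE// ler_nat.
have [phi [_ HP]] := extract_subsequence PG Goo GP.
exists (Num.sqrt q), (z_ \o phi), (f_ \o phi), (rho_ \o phi), u.
split.
  rewrite sqrtr_gt0; split=> //.
  by rewrite -sqrtr1 ltr_sqrt.
split=> [j|].
  split; first by apply/unit_ballE; exact: lt_trans (zq _) q1.
  by rewrite enorm_ltE ?sqrtr_gt0// sqr_sqrtr ?(ltW q0)//; exact: zq.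
split=> [j|]; first exact: Ff.
split=> [j|].
  by split; [exact: rho0|rewrite (le_trans (rho_inv _))// invf_le1// ler1n].
split.
  apply/(@cvgrPdist_le _ R^o) => e e0; near=> m.
  have [_ _ rho_m] := HP m; rewrite sub0r normrN gtr0_norm; last exact: rho0.
  apply: (le_trans rho_m); apply: ltW.
  by near: m; exact: near_infty_natSinv_lt (PosNum e0).
split; first by move=> z _; exact: ud.
split.
  move=> [c uc].
  (* If the limit were the constant [c], some [g_ j] would be within 1/96 of [c] on the unit ball,
     contradicting its derivative at 0. The index 95 stands for 1/96. *)
  have := @compact_uniform _ _ G FG (box 1) (fun j z => normc (g_ j z - u z) <= 96^-1)
    (@box_compact R n 1) (fun x _ => Hu x I _ (eps_gt0 95)).
  move=> HG; have [j [/= dj ju]] := filter_ex (filterI diff_G HG).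
  have := @almost_constant_derivative _ _ _ _ dj (v1 j) c.
  have jc z : rnorm (z - 0) < 1 -> normc (g_ j z - c) <= 96^-1.
    by move=> /unit_box/ju; rewrite uc.
  move=> /(_ jc); apply/negP; rewrite -leNgt; apply: le_trans (below j).
  by rewrite lerDl sqr_ge0.
have exhaust x : [set: 'rV[Cplx R]_n] x -> exists2 d : R, 0 < d &
    \forall m \near \oo, forall z, rnorm (z - x) < d -> box m%:R z.
  move=> _; exists 1 => //; near=> m => z /near_le zx.
  apply: box_ge; apply: (le_trans zx).
  by near: m; exact: nbhs_infty_ger.
move=> K cK _; split.
  have := compact_in_exhaustion exhaust cK (fun _ _ => I).
  by apply: filterS => m Km z /Km; have [_ + _] := HP m; apply.
apply: (cvg_loc_unif_exhaustion exhaust _ cK (fun _ _ => I)) => m z.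
by have [+ _ _] := HP m; apply.
Unshelve. all: by end_near. Qed.
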